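(* Let $\gamma:[0,1]\to\mathbb{R}^d$ be a twice-continuously-differentiable unit-speed path such that the map $s\mapsto|\gamma''_s|$ is non-vanishing on $[0,1]$ and is differentiable with bounded derivative. Let $F$, $X_{(i)}$, $Y_{(i)}$, $\mu_n^X$, $\mu_n^Y$ be associated with $\gamma$ as described in the context. Let $g:=\gamma'\circ F$ on $[a,b]$ and let $\phi(u):=\sup_{|s-t|<u}|g'(t)-g'(s)|$ be the modulus of continuity of $g'$. Then there exists $0<\varepsilon'\le 1$ such that for every $n\in\mathbb{N}$ and every $0<\varepsilon<\varepsilon'$, $$(n!)^2\|S(\gamma)^n\|^2\ \le\ \mathbb{E}\left[\exp\left(-n\sum_{k=1}^\infty\frac{(1-\phi(\varepsilon))^k}{k2^k}W_{2k}^{2k}(\mu_n^X,\mu_n^Y)\right)\mathbf{1}_{\{\max_{i=1,\dots,n}|X_{(i)}-Y_{(i)}|<\varepsilon\}}\right]+\mathbb{P}\left(\max_{i=1,\dots,n}|X_{(i)}-Y_{(i)}|\ge\varepsilon\right).$$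
   Context: $|\cdot|$ is the Euclidean norm; unit-speed means $|\gamma'_s|=1$ for all $s$. The $n$-th signature term is $S(\gamma)^n=\int_{0\le t_1\le\dots\le t_n\le 1}d\gamma_{t_1}\otimes\cdots\otimes d\gamma_{t_n}\in(\mathbb{R}^d)^{\otimes n}$, and $\|\cdot\|$ is the Hilbert-Schmidt norm, i.e. the norm of the inner product with $\langle v_1\otimes\cdots\otimes v_n,w_1\otimes\cdots\otimes w_n\rangle=\prod_i\langle v_i,w_i\rangle$. Associated objects: $a<b$ are real numbers and $F:[a,b]\to[0,1]$ is a cumulative distribution function, twice differentiable on $(a,b)$, with $F(t)=\int_a^t|\gamma''_{F(s)}|^{-1}ds$, $F(a)=0$, $F(b)=1$ (such $a,b,F$ exist for the given $\gamma$). $\{U_{(i)}\}_{i=1}^n$ and $\{V_{(i)}\}_{i=1}^n$ are two independent collections, each being the increasing order statistics of $n$ i.i.d. uniform random variables on $[0,1]$. Set $X_{(i)}:=F^{-1}(U_{(i)})$, $Y_{(i)}:=F^{-1}(V_{(i)})$, $\mu_n^X:=\frac1n\sum_{i=1}^n\delta_{X_{(i)}}$, $\mu_n^Y:=\frac1n\sum_{i=1}^n\delta_{Y_{(i)}}$. $W_p$ is the $p$-Wasserstein distance on probability measures on $\mathbb{R}$: $W_p^p(\mu,\nu)=\inf_\pi\int\int|x-y|^p\,d\pi(x,y)$ over couplings $\pi$ of $\mu,\nu$. The quantity under the expectation is understood to be $0$ where the indicator vanishes. *)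

(* Defs.v *)
From HB Require Import structures.
From mathcomp Require Import all_boot all_order all_algebra.
From mathcomp Require Import all_classical all_reals all_analysis.

Set Implicit Arguments.
Unset Strict Implicit.
Unset Printing Implicit Defensive.

Import Order.TTheory GRing.Theory Num.Theory.
Import numFieldNormedType.Exports.

Local Open Scope classical_set_scope.
Local Open Scope ring_scope.

Section euclidean.
Context {R : realType} {d : nat}.

Definition edot (v w : 'rV[R]_d) : R := \sum_(j < d) v 0 j * w 0 j.

(* The norm `|v| of the library on row vectors is the sup norm; it induces the
   same topology, so limits and continuity below may use the library's. *)
Definition enorm (v : 'rV[R]_d) : R := Num.sqrt (edot v v).

End euclidean.

Section derivative_on_a_set.
Context {R : realType} {V : normedModType R}.

(* Derivative at x of a function that matters only on A: the difference
   quotient is taken along A, so it is one-sided at an endpoint of an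
   interval A. *)
Definition difference_quotient (f : R -> V) (x y : R) : V :=
  (y - x)^-1 *: (f y - f x).

Definition derivable_on (A : set R) (f : R -> V) : Prop :=
  forall x, A x -> cvg (difference_quotient f x y @[y --> within A x^']).

Definition derive_on (A : set R) (f : R -> V) (x : R) : V :=
  lim (difference_quotient f x y @[y --> within A x^']).

End derivative_on_a_set.

Section tensors.
Context {R : realType} {d : nat}.

(* A tensor in the n-th tensor power of R^d is given by its coordinates in the
   basis of simple tensors e_(I 0) (x) ... (x) e_(I (n-1)). *)
Definition tensor (n : nat) : Type := {ffun 'I_n -> 'I_d} -> R.

Definition otimes (n : nat) (v : 'I_n -> 'rV[R]_d) : tensor n :=
  fun I => \prod_(i < n) v i 0 (I i).

Definition hs_dot (n : nat) (S T : tensor n) : R := \sum_I S I * T I.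

Lemma hs_dot_otimes (n : nat) (v w : 'I_n -> 'rV[R]_d) :
  hs_dot (otimes v) (otimes w) = \prod_(i < n) edot (v i) (w i).
Proof.
rewrite /hs_dot /otimes /edot bigA_distr_bigA /=.
by apply: eq_bigr => I _; rewrite big_split.
Qed.

Definition hs_norm (n : nat) (S : tensor n) : R := Num.sqrt (hs_dot S S).

(* Coordinate I of the integral of dx_{t_1} (x) ... (x) dx_{t_n} over
   0 <= t_1 <= ... <= t_n <= t, for a path x with derivative dx (so that
   dx_t = dx(t) dt); the last time t_n is the outermost variable. *)
Fixpoint iterated_integral (dx : R -> 'rV[R]_d) (n : nat) :
    ('I_n -> 'I_d) -> R -> R :=
  match n with
  | 0 => fun _ _ => 1
  | m.+1 => fun I t =>
      \int[lebesgue_measure]_(s in `[0, t])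
        (iterated_integral dx (fun i : 'I_m => I (widen_ord (leqnSn m) i)) s
         * dx s 0 (I ord_max))
  end.

Definition signature (gamma : R -> 'rV[R]_d) (n : nat) : tensor n :=
  fun I => iterated_integral (derive_on `[0, 1] gamma) I 1.

End tensors.

Arguments signature {R d} gamma n _.

Section wasserstein.
Context {R : realType}.

Definition coupling (mu nu : {measure set (measurableTypeR R) -> \bar R})
    (pi : probability (measurableTypeR R * measurableTypeR R)%type R) : Prop :=
  forall A, measurable A -> pi (A `*` setT) = mu A /\ pi (setT `*` A) = nu A.

(* The p-th power W_p^p of the p-Wasserstein distance. *)
Definition wasserstein_pow (p : nat)
    (mu nu : {measure set (measurableTypeR R) -> \bar R}) : \bar R :=
  ereal_inf [set (\int[pi]_z (`|(z.1 : R) - (z.2 : R)| ^+ p)%:E)%E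
            | pi in coupling mu nu].

Definition empirical_measure (n : nat) (x : nat -> R) :
    {measure set (measurableTypeR R) -> \bar R} :=
  mscale (n%:R^-1)%:nng
    (msum (fun k => dirac (x k : measurableTypeR R)) n).

End wasserstein.

Section samples.
Context {disp : measure_display} {T : measurableType disp} {R : realType}.
Local Open Scope ereal_scope.

(* Product rule for the whole family; the rule for a subfamily is the case
   B i = setT outside it. *)
Definition mutually_independent (P : probability T R) (n : nat)
    (X : 'I_n -> {RV P >-> R}) : Prop :=
  forall B : 'I_n -> set (measurableTypeR R), (forall i, measurable (B i)) ->
    P (\bigcap_i (X i @^-1` B i)) = \prod_(i < n) P (X i @^-1` B i).

Definition iid_uniform01 (P : probability T R) (n : nat)
    (X : 'I_n -> {RV P >-> R}) : Prop :=
  mutually_independent X /\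
  forall i (B : set (measurableTypeR R)), measurable B ->
    distribution P (X i) B = uniform_prob (@ltr01 R) B.

Definition independent_collections (P : probability T R) (m n : nat)
    (X : 'I_m -> T -> measurableTypeR R)
    (Y : 'I_n -> T -> measurableTypeR R) : Prop :=
  forall A B, g_sigma_preimage X A -> g_sigma_preimage Y B ->
    P (A `&` B) = P A * P B.

(* Indices are shifted: order_stat X k is the (k+1)-st smallest of the X i,
   for k < n. *)
Definition order_stat (n : nat) (X : 'I_n -> T -> R) (k : nat) (w : T) : R :=
  nth 0%R (sort <=%R [seq X i w | i <- enum 'I_n]) k.

End samples.

(* Compositional inverse of F on [a, b] (arbitrary value a off F([a, b])). *)
Definition inverse_on {R : realType} (a b : R) (F : R -> R) : R -> R :=
  'pinv_(fun=> a) `[a, b] F.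

Definition modulus_of_continuity {R : realType} {d : nat} (A : set R)
    (f : R -> 'rV[R]_d) (u : R) : R :=
  sup [set x | exists s t,
         [/\ A s, A t, `|s - t| < u & x = enorm (f t - f s)]].

Definition max_dist {R : realType} (n : nat) (x y : nat -> R) : R :=
  \big[Num.max/0]_(i < n) `|x i - y i|.

(* Main.v *)
Require Import Defs.
From HB Require Import structures.
From mathcomp Require Import all_boot all_order all_algebra fingroup perm.
From mathcomp Require Import all_classical all_reals all_analysis.
From mathcomp Require Import measurable_realfun ring lra.

Set Implicit Arguments.
Unset Strict Implicit.
Unset Printing Implicit Defensive.

Import Order.TTheory GRing.Theory Num.Theory.
Import numFieldNormedType.Exports.

Local Open Scope classical_set_scope.
Local Open Scope ring_scope.

(** The n-th signature term integrates the tensor of velocities over the simplex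
    of ordered times, on which n! dt is the joint law of the order statistics of
    n independent uniform variables.  With two independent samples U and V the
    squared Hilbert-Schmidt norm therefore becomes an expectation
    ([expectation_prod_edot]):
      (n!)^2 |S|^2 = E [ prod_i <gamma'(U_(i)), gamma'(V_(i))> ].
    Behind it is [expectation_order_stat]: each of the n! orderings of the sample
    contributes the same iterated integral, computed by conditioning on the
    largest variable and recursing ([expectation_chain_weight]).

    Write gamma'(U_(i)) = g(X_(i)) with g = gamma' o F.  The distribution function
    F has density 1/|gamma''(F)|, so that g is a unit-speed curve on the unit
    sphere.  Unit vectors satisfy <v, w> = 1 - |v - w|^2 / 2, and while the
    velocity of g turns by at most phi <= 1 the squared chord |g(x) - g(y)|^2 lies
    between (1 - phi) (x - y)^2 and (x - y)^2.  Hence, on the event that all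
    |X_(i) - Y_(i)| are smaller than eps, each factor of the product lies between
    0 and 1 - z_i, where z_i = (1 - phi) |X_(i) - Y_(i)|^2 / 2
    ([edot_chord_ge], [edot_chord_le]); off this event the product is at most 1.

    It remains to recognise the exponential.  Every partial sum of the logarithmic
    series gives 1 - z <= exp (- sum_k z^k / k) ([one_minus_le_expR]), and pairing
    X_(i) with Y_(i) is one particular coupling of the two empirical measures, so
    W_2k^2k is at most the mean of the |X_(i) - Y_(i)|^2k
    ([wasserstein_pow_empirical_le]).  Replacing these means by the smaller
    Wasserstein costs only increases the exponential
    ([prod_le_expR_wasserstein]).  As Wasserstein costs are infima over couplings,
    the expectations are compared through the monotonicity of the integral for
    arbitrary nonnegative functions ([ge0_le_integral_nonmeasurable]). *)

(** * Euclidean geometry of row vectors *)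

Section euclidean_geometry.
Context (R : realType) (d : nat).
Implicit Types v w : 'rV[R]_d.

Lemma edotC v w : edot v w = edot w v.
Proof. by apply: eq_bigr => j _; rewrite mulrC. Qed.

Lemma edotDr u v w : edot u (v + w) = edot u v + edot u w.
Proof. by rewrite /edot -big_split; apply: eq_bigr => j _; rewrite mxE mulrDr. Qed.

Lemma edotZr a v w : edot v (a *: w) = a * edot v w.
Proof. by rewrite /edot mulr_sumr; apply: eq_bigr => j _; rewrite mxE mulrCA. Qed.

Lemma edotBr u v w : edot u (v - w) = edot u v - edot u w.
Proof. by rewrite edotDr -scaleN1r edotZr mulN1r. Qed.

Lemma edot_ge0 v : 0 <= edot v v.
Proof. by apply: sumr_ge0 => j _; rewrite -expr2 sqr_ge0. Qed.

Lemma edot_eq0 v w : edot v v = 0 -> edot v w = 0.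
Proof.
move=> /eqP; rewrite psumr_eq0 => [/allP v0|j _]; last by rewrite -expr2 sqr_ge0.
apply: big1 => j _; have := v0 j (mem_index_enum j).
by rewrite mulf_eq0 orbb => /eqP ->; rewrite mul0r.
Qed.

Lemma sqr_enorm v : enorm v ^+ 2 = edot v v.
Proof. by rewrite sqr_sqrtr// edot_ge0. Qed.

Lemma enorm_ge0 v : 0 <= enorm v. Proof. exact: sqrtr_ge0. Qed.

Lemma enormZ a v : 0 <= a -> enorm (a *: v) = a * enorm v.
Proof.
move=> a0; apply/eqP; rewrite -(@eqrXn2 _ 2) ?enorm_ge0 ?mulr_ge0 ?enorm_ge0//.
by rewrite exprMn !sqr_enorm edotZr edotC edotZr expr2 mulrA.
Qed.

(** Expanding 0 <= | |w|^2 v - <v, w> w |^2 gives the squared Cauchy-Schwarz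
    inequality times |w|^2, whence the separate treatment of |w| = 0. *)
Lemma edot_le_enorm v w : edot v w <= enorm v * enorm w.
Proof.
have := edot_ge0 w; rewrite le_eqVlt => /predU1P[w0|w0].
  by rewrite edotC edot_eq0// mulr_ge0// enorm_ge0.
have sq : edot v w ^+ 2 <= edot v v * edot w w.
  have := edot_ge0 (edot w w *: v - edot v w *: w).
  rewrite edotBr !edotZr ![edot (_ - _) _]edotC !edotBr !edotZr (edotC w v).
  set x := edot v v; set y := edot w w; set z := edot v w => H.
  have {H} : 0 <= y * (x * y - z ^+ 2) by move: H; congr (_ <= _); ring.
  by rewrite pmulr_rge0// subr_ge0.
have [vw|vw] := leP 0 (edot v w); last first.
  by rewrite (le_trans (ltW vw))// mulr_ge0// enorm_ge0.
by rewrite -ler_sqr ?nnegrE ?mulr_ge0 ?enorm_ge0// exprMn !sqr_enorm.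
Qed.

Lemma edot_unit v w : enorm v = 1 -> enorm w = 1 ->
  edot v w = 1 - enorm (w - v) ^+ 2 / 2.
Proof.
move=> v1 w1; rewrite sqr_enorm edotBr ![edot (_ - _) _]edotC !edotBr.
by rewrite -!sqr_enorm v1 w1 (edotC w v); field.
Qed.

Lemma continuous_edot v : continuous (edot v : 'rV[R]_d -> R).
Proof.
apply: (continuous_big (@add_continuous _)) => j _ w.
apply: (@continuousM R 'rV[R]_d (fun=> v 0 j) (fun u : 'rV[R]_d => u 0 j) w).
  exact: cst_continuous.
exact: coord_continuous.
Qed.

Lemma continuous_enorm : continuous (enorm : 'rV[R]_d -> R).
Proof.
move=> v; apply: (@continuous_comp _ _ _ (fun v => edot v v) Num.sqrt).
  apply: (continuous_big (@add_continuous _)) => j _ w.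
  pose coord (u : 'rV[R]_d) := u 0 j.
  by apply: (@continuousM R 'rV[R]_d coord coord w); exact: coord_continuous.
exact: sqrt_continuous.
Qed.

End euclidean_geometry.

Section enorm_triangle.
Context (R : realType) (d : nat).
Implicit Types v w : 'rV[R]_d.

Lemma enormN v : enorm (- v) = enorm v.
Proof. by rewrite /enorm -scaleN1r edotZr edotC edotZr mulrA mulrNN !mul1r. Qed.

Lemma ler_enormD v w : enorm (v + w) <= enorm v + enorm w.
Proof.
rewrite -ler_sqr ?nnegrE ?addr_ge0 ?enorm_ge0// sqrrD !sqr_enorm.
rewrite edotDr ![edot (_ + _) _]edotC !edotDr (edotC w v).
have := edot_le_enorm v w.
rewrite -(ler_pMn2r (n:=2))// !mulr2n => vw; lra.
Qed.

End enorm_triangle.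

Lemma normr_edot_le (R : realType) d (v w : 'rV[R]_d) :
  `|edot v w| <= enorm v * enorm w.
Proof.
rewrite ler_norml edot_le_enorm andbT lerNl -(enormN w).
by apply: le_trans (edot_le_enorm _ _); rewrite -[- w]scaleN1r edotZr mulN1r.
Qed.

Lemma coord_le_enorm (R : realType) d (v : 'rV[R]_d) j : `|v 0 j| <= enorm v.
Proof.
rewrite -ler_sqr ?nnegrE ?enorm_ge0// sqr_enorm -normrX ger0_norm ?sqr_ge0//.
rewrite /edot (bigD1 j)//= -expr2 lerDl sumr_ge0// => i _.
by rewrite -expr2 sqr_ge0.
Qed.

(** * Limits, continuity and derivatives along a subset of the line *)

Section epsilon_delta.
Context (R : realType).

(** Derivatives and continuity along a segment are handled by explicit radii in
    this part, because the filters at an end point and at an interior point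
    differ, whereas their epsilon-delta forms read the same. *)
Lemma near_within_nbhsP (A : set R) (x : R) (P : set R) :
  (\forall y \near within A (nbhs x), P y) <->
  exists2 e, 0 < e & forall y, A y -> `|y - x| < e -> P y.
Proof.
split=> [/nbhs_ballP[e e0 xeP]|[e e0 xeP]].
  by exists e => // y Ay yx; apply: xeP => //; rewrite /ball/= distrC.
apply/nbhs_ballP; exists e => // y xy Ay; apply: xeP => //.
by rewrite distrC.
Qed.

Lemma near_within_dnbhsP (A : set R) (x : R) (P : set R) :
  (\forall y \near within A x^', P y) <->
  exists2 e, 0 < e & forall y, A y -> y != x -> `|y - x| < e -> P y.
Proof.
split=> [/nbhs_ballP[e e0 xeP]|[e e0 xeP]].
  by exists e => // y Ay yx yxe; apply: xeP => //; rewrite /ball/= distrC.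
apply/nbhs_ballP; exists e => // y xy yx Ay; apply: xeP => //.
by rewrite distrC.
Qed.

Lemma within_continuousP (V : normedModType R) (A : set R) (f : R -> V) :
  {within A, continuous f} <-> forall x, A x -> forall e, 0 < e ->
    exists2 e', 0 < e' & forall y, A y -> `|y - x| < e' -> `|f x - f y| < e.
Proof.
rewrite subspace_continuousP; split => cf x Ax.
  by move=> e e0; move/cvgrPdist_lt : (cf x Ax) => /(_ _ e0)/near_within_nbhsP.
by apply/cvgrPdist_lt => e e0; apply/near_within_nbhsP; exact: cf.
Qed.

Lemma difference_quotient_cvgP (V : normedModType R) (A : set R) (f : R -> V)
    (x : R) (l : V) :
  difference_quotient f x y @[y --> within A x^'] --> l <->
  forall e, 0 < e -> exists2 e', 0 < e' &
    forall y, A y -> y != x -> `|y - x| < e' -> `|l - difference_quotient f x y| < e.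
Proof.
split=> [/cvgrPdist_lt fl e e0|fl]; first by apply/near_within_dnbhsP; exact: fl.
by apply/cvgrPdist_lt => e e0; apply/near_within_dnbhsP; exact: fl.
Qed.

(** A nondegenerate segment accumulates at each of its points, end points
    included; this is what makes limits along it unique. *)
Lemma within_dnbhs_proper (a b x : R) : a < b -> a <= x <= b ->
  ProperFilter (within `[a, b] x^').
Proof.
move=> ab /andP[ax xb]; split; last exact: within_filter.
move=> /near_within_dnbhsP[e e0 H].
have [xb'|bx] := ltP x b.
- pose y := Num.min b (x + e / 2).
  have xy : x < y by rewrite lt_min xb' ltrDl divr_gt0.
  apply: (H y); rewrite ?gt_eqF//.
    by rewrite /= in_itv/= (le_trans ax (ltW xy)) ge_min lexx.
  rewrite ger0_norm ?subr_ge0 ?ltW// ltrBlDl gt_min ltrD2l.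
  by rewrite [e / 2 < e]ltr_pdivrMr// ltr_pMr// ltr1n orbT.
- pose y := Num.max a (x - e / 2).
  have yx : y < x.
    by rewrite gt_max (lt_le_trans ab bx) gtrBl divr_gt0.
  apply: (H y); rewrite ?lt_eqF//.
    by rewrite /= in_itv/= le_max lexx (le_trans (ltW yx) xb).
  rewrite distrC ger0_norm ?subr_ge0 ?ltW// ltrBlDr -ltrBlDl lt_max.
  rewrite ltrD2l ltrN2 [e / 2 < e]ltr_pdivrMr// ltr_pMr// ltr1n orbT//.
Qed.

Lemma derive_on_eq (V : normedModType R) (a b x : R) (f : R -> V) (l : V) :
  a < b -> a <= x <= b ->
  difference_quotient f x y @[y --> within `[a, b] x^'] --> l ->
  derive_on `[a, b] f x = l.
Proof.
by move=> ab abx fl; have := within_dnbhs_proper ab abx => ?; exact: cvg_lim.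
Qed.

Lemma derive_onP (V : normedModType R) (A : set R) (x : R) (f : R -> V) :
  derivable_on A f -> A x ->
  difference_quotient f x y @[y --> within A x^'] --> derive_on A f x.
Proof. by move=> df Ax; exact: df. Qed.

(** Near x the difference quotient is bounded by |df x| + 1, which gives a
    local Lipschitz estimate at x. *)
Lemma difference_quotient_continuous (V : normedModType R) (A : set R)
    (f df : R -> V) :
  (forall x, A x -> difference_quotient f x y @[y --> within A x^'] --> df x) ->
  {within A, continuous f}.
Proof.
move=> fdf; apply/within_continuousP => x Ax e e0.
have /difference_quotient_cvgP /(_ 1 ltr01)[d d0 fd] := fdf x Ax.
have K0 : 0 < `|df x| + 1 by rewrite ltr_pwDr.
exists (Num.min d (e / (`|df x| + 1))) => [|y Ay].
  by rewrite lt_min d0 divr_gt0.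
rewrite lt_min => /andP[yxd yxe].
have [->|yx] := eqVneq y x; first by rewrite subrr normr0.
have yx0 : y - x != 0 by rewrite subr_eq0.
have -> : f x - f y = - ((y - x) *: difference_quotient f x y).
  by rewrite /difference_quotient scalerA mulfV// scale1r opprB.
rewrite normrN normrZ.
have dq : `|difference_quotient f x y| < `|df x| + 1.
  rewrite -[difference_quotient _ _ _](subKr (df x)).
  by rewrite (le_lt_trans (ler_normB _ _))// ltrD2l fd.
apply: le_lt_trans (_ : `|y - x| * (`|df x| + 1) < e).
  by rewrite ler_wpM2l// ltW.
by rewrite -ltr_pdivlMr.
Qed.

Lemma derivable_on_continuous (V : normedModType R) (A : set R) (f : R -> V) :
  derivable_on A f -> {within A, continuous f}.
Proof.
move=> df; apply: (@difference_quotient_continuous _ _ _ (derive_on A f)) => x.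
exact: derive_onP.
Qed.

(** Composition relative to sets: it suffices that f maps A into the set along
    which g is continuous. *)
Lemma continuous_within_comp (V : topologicalType) (A B : set R) (f : R -> R)
    (g : R -> V) :
  (forall x, A x -> B (f x)) ->
  {within A, continuous f} -> {within B, continuous g} ->
  {within A, continuous (g \o f)}.
Proof.
move=> AB /within_continuousP cf /subspace_continuousP cg.
apply/subspace_continuousP => x Ax.
have fx : f y @[y --> within A (nbhs x)] --> within B (nbhs (f x)).
  move=> P /near_within_nbhsP[e e0 fxP]; apply/near_within_nbhsP.
  have [d d0 fd] := cf x Ax e e0; exists d => // y Ay yx.
  by apply: fxP; [exact: AB|rewrite distrC fd].
exact: cvg_comp fx (cg _ (AB _ Ax)).
Qed.

(** The chain rule along sets. Injectivity of f lets the difference quotient of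
    g o f factor exactly as the product of two difference quotients, so no
    remainder term has to be estimated. *)
Lemma difference_quotient_comp (V : normedModType R) (A B : set R) (f : R -> R)
    (g : R -> V) (x f' : R) (g' : V) :
  (forall y, A y -> B (f y)) -> {in A &, injective f} -> A x ->
  {within A, continuous f} ->
  difference_quotient (f : R -> R^o) x y @[y --> within A x^'] --> f' ->
  difference_quotient g (f x) z @[z --> within B (f x)^'] --> g' ->
  difference_quotient (g \o f) x y @[y --> within A x^'] --> f' *: g'.
Proof.
move=> AB injf Ax /within_continuousP cf dqf dqg.
have fx : f y @[y --> within A x^'] --> within B (f x)^'.
  move=> P /near_within_dnbhsP[e e0 fxP]; apply/near_within_dnbhsP.
  have [d d0 fd] := cf x Ax e e0; exists d => // y Ay yx yxd.
  apply: fxP; [exact: AB| |by rewrite distrC fd].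
  by apply: contra_neq yx => /injf; apply; rewrite inE.
have := cvgZ dqf (cvg_comp _ _ fx dqg).
have FF : Filter (within A x^') by exact: within_filter.
move=> H; refine (cvg_trans _ (H FF)); apply: near_eq_cvg; apply/near_within_dnbhsP.
exists 1 => // y Ay yx _.
have fyx : f y - f x != 0.
  by rewrite subr_eq0; apply: contra_neq yx => /injf; apply; rewrite inE.
rewrite /difference_quotient/= scalerA -[_ *: (f y - f x)]/(_ * _).
by rewrite -mulrA mulfV// mulr1.
Qed.

End epsilon_delta.

(** * The distribution function with density 1/q(F), and its inverse *)

Lemma lebesgue_measure_segment_lty (R : realType) (x y : R) (ba bb : bool) :
  (lebesgue_measure ([set` Interval (BSide ba x) (BSide bb y)] : set R) < +oo)%E.
Proof.
by rewrite lebesgue_measure_itv; case: ifP => _; rewrite ?ltry// -EFinD ltry.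
Qed.

Section cdf_of_reciprocal_speed.
Context (R : realType) (a b : R) (q F : R -> R).
Context (ab : a < b).
Context (q_continuous : {within `[0, 1], continuous q}).
Context (q_gt0 : forall u, u \in `[0, 1] -> 0 < q u).
Context (F_range : forall t, t \in `[a, b] -> F t \in `[0, 1]).
Context (F_derivable : forall t, t \in `]a, b[ -> derivable F t 1).
Context (F_integral : forall t, t \in `[a, b] ->
  F t = \int[lebesgue_measure]_(s in `[a, t]) (q (F s))^-1).

Let rho s := (q (F s))^-1.

Lemma reciprocal_continuous : {within `[0, 1], continuous (fun u => (q u)^-1)}.
Proof.
apply/subspace_continuousP => u u01; apply: cvgV; first by rewrite gt_eqF ?q_gt0.
by move/subspace_continuousP : q_continuous; exact.
Qed.

(** q is continuous and positive on a compact set, so 1/q(F) is bounded away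
    from 0 and from infinity. *)
Lemma density_bounds : exists m K, 0 < m /\ forall s, s \in `[a, b] -> m <= rho s <= K.
Proof.
have [c c01 qc] := EVT_min ler01 q_continuous.
have [C C01 qC] := EVT_max ler01 q_continuous.
exists (q C)^-1, (q c)^-1; split; first by rewrite invr_gt0 q_gt0.
move=> s /F_range Fs; rewrite /rho !lef_pV2 ?posrE ?q_gt0//.
by rewrite qc ?qC.
Qed.

(** Only differentiability of F inside the segment is available at this stage;
    the two end points are added as singletons. Continuity of F on the closed
    segment comes later, and rests on this measurability. *)
Lemma measurable_density : measurable_fun `[a, b] rho.
Proof.
have -> : `[a, b]%classic = a |` (`]a, b[ `|` [set b]).
  by rewrite setUitv1 ?setU1itv// bnd_simp// ltW.
apply/measurable_funU => //; first exact: measurableU.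
split; first exact: measurable_fun_set1.
apply/measurable_funU => //; split; last exact: measurable_fun_set1.
apply: subspace_continuous_measurable_fun => //.
suff : {within `]a, b[, continuous ((fun u => (q u)^-1) \o F)} by [].
apply: (@continuous_within_comp R R _ `[0, 1]%classic F (fun u => (q u)^-1)).
- by move=> x xab; apply: F_range; exact: subset_itv_oo_cc.
- apply: continuous_in_subspaceT => x /[!inE] xab.
  exact/differentiable_continuous/derivable1_diffP/F_derivable.
- exact: reciprocal_continuous.
Qed.

Lemma integrable_density : lebesgue_measure.-integrable `[a, b] (EFin \o rho).
Proof.
have [m [K [m0 mK]]] := density_bounds.
apply: (@measurable_bounded_integrable _ _ _ lebesgue_measure) => //.
- exact: lebesgue_measure_segment_lty.
- exact: measurable_density.
exists K; split; first exact: num_real.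
move=> M KM s sab; have /andP[ms sK] := mK s sab.
rewrite /= ger0_norm; first exact: le_trans sK (ltW KM).
exact: le_trans (ltW m0) ms.
Qed.

(** With constants m and K coming from the global bounds on the density this
    makes F bi-Lipschitz; with constants close to the density at a point it
    gives the derivative of F there, end points included. *)
Lemma cdf_increment s t m K : a <= s -> s <= t -> t <= b ->
  (forall u, u \in `[s, t] -> m <= rho u <= K) ->
  m * (t - s) <= F t - F s <= K * (t - s).
Proof.
move=> as_ st tb mK.
have sub : `]s, t] `<=` `[a, b] by apply: subset_itv; rewrite bnd_simp.
have int_st : lebesgue_measure.-integrable `]s, t] (EFin \o rho).
  exact: integrableS integrable_density.
have int_at : lebesgue_measure.-integrable `[a, t] (EFin \o rho).
  by apply: integrableS integrable_density => //; apply: subset_itv; rewrite bnd_simp.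
have cst_int (c : R) : lebesgue_measure.-integrable `]s, t] (EFin \o cst c).
  apply: (@measurable_bounded_integrable _ _ _ lebesgue_measure) => //.
    exact: lebesgue_measure_segment_lty.
  exact: bounded_cst.
have lE : lebesgue_measure (`]s, t]%classic : set R) = (t - s)%:E.
  rewrite lebesgue_measure_itv/= lte_fin.
  by move: st; rewrite le_eqVlt => /predU1P[->|->//]; rewrite ltxx subrr.
have cstE (c : R) : \int[lebesgue_measure]_(_ in `]s, t]) c = c * (t - s).
  rewrite Rintegral_cst//; transitivity (c * fine (t - s)%:E) => //.
  by congr (_ * fine _); exact: lE.
have -> : F t - F s = \int[lebesgue_measure]_(u in `]s, t]) rho u.
  rewrite !F_integral ?in_itv/= ?(le_trans as_ st)// ?as_ ?(le_trans st tb)//.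
  by rewrite Rintegral_itvB ?bnd_simp.
rewrite -!cstE; apply/andP; split.
- apply: le_Rintegral => //; first exact: cst_int.
  by move=> u /subset_itv_oc_cc/mK/andP[].
- apply: le_Rintegral => //; first exact: cst_int.
  by move=> u /subset_itv_oc_cc/mK/andP[].
Qed.

Lemma cdf_lt s t : a <= s -> s < t -> t <= b -> F s < F t.
Proof.
move=> as_ st tb; have [m [K [m0 mK]]] := density_bounds.
have /andP[+ _] : m * (t - s) <= F t - F s <= K * (t - s).
  apply: cdf_increment => //; first exact: ltW.
  move=> u; rewrite in_itv/= => /andP[su ut]; apply: mK.
  by rewrite in_itv/= (le_trans as_ su) (le_trans ut).
by rewrite -subr_gt0; apply: lt_le_trans; rewrite mulr_gt0// subr_gt0.
Qed.

Lemma cdf_inj : {in `[a, b]%classic &, injective F}.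
Proof.
move=> s t /[!inE]/= /[!in_itv]/= /andP[as_ sb] /andP[at_ tb] Fst.
have [st|ts|//] := ltgtP s t.
  by have := cdf_lt as_ st tb; rewrite Fst ltxx.
by have := cdf_lt at_ ts sb; rewrite Fst ltxx.
Qed.

(** A form of [cdf_increment] that treats both signs of y - x at once. *)
Lemma cdf_slope_bounds x y m K : x \in `[a, b] -> y \in `[a, b] -> y != x ->
  (forall u, u \in `[a, b] -> `|u - x| <= `|y - x| -> m <= rho u <= K) ->
  m <= (y - x)^-1 * (F y - F x) <= K.
Proof.
rewrite !in_itv/= => /andP[ax xb] /andP[ay yb] yx mK.
have ratio s t : a <= s -> s < t -> t <= b ->
    (forall u, u \in `[s, t] -> m <= rho u <= K) ->
    m <= (t - s)^-1 * (F t - F s) <= K.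
  move=> as_ st tb mK'; have := cdf_increment as_ (ltW st) tb mK'.
  by rewrite [(t - s)^-1 * _]mulrC ler_pdivlMr ?ler_pdivrMr ?subr_gt0.
have [xy|yx'|eqxy] := ltgtP x y; last by rewrite eqxy eqxx in yx.
- apply: ratio => // u; rewrite in_itv/= => /andP[xu uy]; apply: mK.
    by rewrite in_itv/= (le_trans ax xu) (le_trans uy).
  by rewrite !ger0_norm ?subr_ge0 ?lerD2r// ltW.
- rewrite -[y - x]opprB invrN mulNr -mulrN opprB.
  apply: ratio => // u; rewrite in_itv/= => /andP[yu ux]; apply: mK.
    by rewrite in_itv/= (le_trans ay yu) (le_trans ux).
  by rewrite !ler0_norm ?subr_le0 ?lerN2 ?lerD2r// ltW.
Qed.

Lemma cdf_continuous : {within `[a, b], continuous F}.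
Proof.
have [m [K [m0 mK]]] := density_bounds.
apply/(@within_continuousP R R^o) => x xab e e0.
have K0 : 0 < K.
  by have /andP[mr rK] := mK x xab; rewrite (lt_le_trans m0)// (le_trans mr).
exists (e / K) => [|y yab]; first by rewrite divr_gt0.
rewrite ltr_pdivlMr// => yxe; rewrite distrC.
have [->|yx] := eqVneq y x; first by rewrite subrr normr0.
have /andP[mr rK] := cdf_slope_bounds xab yab yx (fun u uab _ => mK u uab).
apply: le_lt_trans yxe; rewrite mulrC.
have yx0 : y - x != 0 by rewrite subr_eq0.
rewrite -[F y - F x](mulVKf yx0) normrM mulrC ler_wpM2l//.
by rewrite ger0_norm// (le_trans (ltW m0)).
Qed.

Lemma density_continuous : {within `[a, b], continuous rho}.
Proof.
suff : {within `[a, b], continuous ((fun u => (q u)^-1) \o F)} by [].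
apply: (@continuous_within_comp R R _ `[0, 1]%classic F (fun u => (q u)^-1)).
- exact: F_range.
- exact: cdf_continuous.
- exact: reciprocal_continuous.
Qed.

(** The fundamental theorem of calculus, one-sided at the end points: the
    increment is squeezed between the extreme values of the density. *)
Lemma cdf_difference_quotient x : x \in `[a, b] ->
  difference_quotient (F : R -> R^o) x y @[y --> within `[a, b] x^'] --> rho x.
Proof.
move=> xab; apply/(@difference_quotient_cvgP R R^o) => e e0.
have /(@within_continuousP R R^o)/(_ x xab (e / 2)) := density_continuous.
rewrite divr_gt0// => /(_ isT)[d d0 rd]; exists d => // y yab yx yxd.
have /andP[l u] : rho x - e / 2 <= (y - x)^-1 * (F y - F x) <= rho x + e / 2.
  apply: cdf_slope_bounds => // u uab ux.
  by rewrite -ler_distl distrC ltW// rd// (le_lt_trans ux).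
rewrite -[difference_quotient _ _ _]/((y - x)^-1 * (F y - F x)).
apply: (@le_lt_trans _ _ (e / 2)); first by rewrite distrC ler_distl l u.
by rewrite ltr_pdivrMr// ltr_pMr// ltr1n.
Qed.

End cdf_of_reciprocal_speed.

Section inverse_of_increasing.
Context (R : realType) (a b c d : R) (F : R -> R).
Context (ab : a <= b).
Context (F_continuous : {within `[a, b], continuous F}).
Context (F_lt : forall s t, a <= s -> s < t -> t <= b -> F s < F t).
Context (Fa : F a = c) (Fb : F b = d).
Local Notation G := (inverse_on a b F).

Lemma inverse_on_image u : c <= u <= d -> G u \in `[a, b] /\ F (G u) = u.
Proof.
move=> /andP[cu ud].
have [x xab xu] : exists2 x, x \in `[a, b] & F x = u.
  apply: IVT => //.
  by rewrite Fa Fb ge_min cu le_max ud orbT.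
have uF : (F @` `[a, b])%classic u by exists x.
split; last by rewrite /inverse_on pinvK// inE.
have sF : set_surj `[a, b] (F @` `[a, b]) F by [].
by apply: (surjpinv_image_sub (dflt:=fun=> a) sF); exists u.
Qed.

(** Off the range of F the inverse takes the default value a. As F a = c, the
    composite F o G sends every point outside [c, d] to c, and is the identity
    on [c, d]. *)
Lemma inverse_on_outside u : ~~ (c <= u <= d) -> G u = a.
Proof.
move=> ucd; rewrite /inverse_on /pinv_ splitV [X in odflt _ X]oinv_surj.
case: pselect => // uF; exfalso; case: uF => x /=.
rewrite in_itv/= => /andP[ax xb] Fx.
case/negP: ucd; rewrite -Fx -Fa -Fb; apply/andP; split.
  by move: ax; rewrite le_eqVlt => /predU1P[->//|ax]; exact/ltW/F_lt.
by move: xb; rewrite le_eqVlt => /predU1P[->//|xb]; exact/ltW/F_lt.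
Qed.

Lemma inverse_on_segment u : G u \in `[a, b].
Proof.
have [/inverse_on_image[]//|/inverse_on_outside ->] := boolP (c <= u <= d).
by rewrite in_itv/= lexx.
Qed.

(** G is monotone on [c, d] but not on the line, where it falls back to a; the
    preimage of a ray starting at t in [a, b) is still the single interval
    (F t, d]. *)
Lemma measurable_inverse_on : measurable_fun setT G.
Proof.
apply: (measurability _ (RGenOInfty.measurableE R)) => _ [_ [t ->] <-].
rewrite setTI.
have Gab u : a <= G u <= b by have := inverse_on_segment u; rewrite in_itv.
have [ta|at_] := ltP t a.
  rewrite (_ : _ @^-1` _ = setT)//; apply/seteqP; split => // u _ /=.
  by rewrite in_itv/= andbT (lt_le_trans ta)//; have /andP[] := Gab u.
have [bt|tb] := leP b t.
  rewrite (_ : _ @^-1` _ = set0)//; apply/seteqP; split => // u /=.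
  rewrite in_itv/= andbT ltNge (le_trans _ bt)//.
  by have /andP[] := Gab u.
rewrite (_ : _ @^-1` _ = `]F t, d]%classic)//; apply/seteqP; split => u /=.
  rewrite !in_itv/= andbT => tG.
  have [/andP[cu ud]|/inverse_on_outside Ga] := boolP (c <= u <= d).
    have [_ FG] := inverse_on_image (introT andP (conj cu ud)).
    by rewrite ud andbT -{1}FG F_lt//; have /andP[] := Gab u.
  by rewrite Ga ltNge at_ in tG.
rewrite !in_itv/= andbT => /andP[tu ud].
have cF : c <= F t.
  by move: at_; rewrite -Fa le_eqVlt => /predU1P[->//|at_]; exact/ltW/F_lt/ltW.
have [_ FG] := inverse_on_image (introT andP (conj (le_trans cF (ltW tu)) ud)).
rewrite ltNge; apply/negP => Gt; move: tu; rewrite -FG ltNge => /negP; apply.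
have /andP[aG _] := Gab u.
by move: Gt; rewrite le_eqVlt => /predU1P[->//|Gt]; exact/ltW/F_lt/ltW.
Qed.
End inverse_of_increasing.

(** * Chords of a unit-speed curve on the unit sphere *)

Section unit_speed_curve.
Context (R : realType) (d : nat) (a b : R) (g k : R -> 'rV[R]_d).
Context (g_unit : forall t, t \in `[a, b] -> enorm (g t) = 1).
Context (k_unit : forall t, t \in `[a, b] -> enorm (k t) = 1).
Context (g_derivative : forall t, t \in `[a, b] ->
  difference_quotient g t y @[y --> within `[a, b] t^'] --> k t).
Context (k_continuous : {within `[a, b], continuous k}).

(** Heine's theorem, from the near-covering form of compactness: around each x
    half of the local radius of continuity serves all nearby points. *)
Lemma uniformly_continuous_segment e : 0 < e -> exists2 e', 0 < e' &
  forall s t, s \in `[a, b] -> t \in `[a, b] -> `|s - t| < e' ->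
    enorm (k t - k s) < e.
Proof.
move=> e0.
have /compact_near_coveringP/near_covering_withinP cov := @segment_compact R a b.
have : \forall e' \near 0^'+, `[a, b] `<=` [set s | forall t, t \in `[a, b] ->
    `|s - t| < e' -> enorm (k t - k s) < e].
  apply: cov => x xab.
  have [eta eta0 kx] : exists2 eta, 0 < eta & forall y, y \in `[a, b] ->
      `|y - x| < eta -> enorm (k y - k x) < e / 2.
    have c0 : enorm (k y - k x) @[y --> within `[a, b] (nbhs x)] --> (0 : R).
      have -> : 0 = enorm (k x - k x).
        rewrite subrr /enorm /edot big1 ?sqrtr0// => j _.
        by rewrite mxE mul0r.
      apply: (@cvg_comp _ _ _ k (fun v => enorm (v - k x)) _ (nbhs (k x))).
        by move/subspace_continuousP : k_continuous; exact.
      apply: (@continuous_comp _ _ _ (fun v : 'rV[R]_d => v - k x) enorm (k x)).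
        apply: (@continuousB _ _ _ id (fun=> k x) (k x)); first exact: cvg_id.
        exact: cst_continuous.
      exact: continuous_enorm.
    move/cvgrPdist_lt : c0 => /(_ (e / 2)); rewrite divr_gt0// => /(_ isT).
    move=> /near_within_nbhsP[eta eta0 H]; exists eta => // y yab yx.
    by have := H y yab yx; rewrite sub0r normrN ger0_norm// enorm_ge0.
  near=> s r => sab t tab st.
  have sx : `|s - x| < eta / 2.
    by near: s; apply: cvgr_distC_lt; rewrite ?divr_gt0.
  have reta : r < eta / 2 by near: r; apply: nbhs_right_lt; rewrite divr_gt0.
  have -> : k t - k s = (k t - k x) + - (k s - k x) by rewrite opprB addrA subrK.
  (* Both t and s are within eta of x, the radius being split in two halves. *)
  have tx : `|t - x| < eta.
    have -> : t - x = (t - s) + (s - x) by rewrite addrA subrK.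
    rewrite (le_lt_trans (ler_normD _ _))// (splitr eta) ltrD//.
    by rewrite distrC (lt_trans st).
  have sx' : `|s - x| < eta.
    by rewrite (lt_trans sx)// ltr_pdivrMr// ltr_pMr// ltr1n.
  rewrite (le_lt_trans (ler_enormD _ _))// enormN [ltRHS](splitr e).
  by rewrite ltrD// kx.
move=> Hcov; have /filter_ex[e' [e'0 He']] : \forall e' \near (0:R)^'+, 0 < e' /\
    `[a, b] `<=` [set s | forall t, t \in `[a, b] ->
      `|s - t| < e' -> enorm (k t - k s) < e].
  by near=> e'; split; near: e'; [exact: nbhs_right_gt|exact: Hcov].
by exists e' => // s t sab; exact: He'.
Unshelve. all: by end_near. Qed.

(** At an interior point the limit along the segment is the ordinary two-sided
    limit, so scalar projections of g have the usual derivative and the mean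
    value theorem applies to them. *)
Lemma is_derive_edot v t : t \in `]a, b[ ->
  is_derive t 1 (fun s => edot v (g s)) (edot v (k t)).
Proof.
rewrite in_itv/= => /andP[at_ tb].
have tab : t \in `[a, b] by rewrite in_itv/= !ltW.
suff : (fun h => h^-1 *: (((fun s => edot v (g s)) \o shift t) (h *: 1)
                          - edot v (g t))) @ 0^' --> edot v (k t).
  move=> H; apply: DeriveDef; first exact: cvgP H.
  exact: cvg_lim H.
have dq := cvg_comp _ _ (g_derivative tab) (@continuous_edot _ _ v (k t)).
apply/cvgrPdist_lt => e e0.
move/cvgrPdist_lt : dq => /(_ e e0)/near_within_dnbhsP[e' e'0 H].
apply/nbhs_ballP; exists (Num.min e' (Num.min (t - a) (b - t))) => /=.
  by rewrite !lt_min e'0 !subr_gt0 at_ tb.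
move=> h; rewrite /ball/= sub0r normrN !lt_min => /and3P[he ha hb] h0.
have -> : h^-1 *: (edot v (g (h *: 1 + t)) - edot v (g t)) =
    edot v (difference_quotient g t (h + t)).
  by rewrite /difference_quotient edotZr edotBr addrK /GRing.scale/= mulr1.
apply: H; last by rewrite addrK.
  rewrite /= in_itv/=; move: ha hb; rewrite !ltr_norml; lra.
by rewrite -subr_eq0 addrK.
Qed.

(** The mean value theorem fails for vector-valued maps but holds for each
    scalar projection; choosing the direction v well replaces it. *)
Lemma edot_MVT v x y : x \in `[a, b] -> y \in `[a, b] -> x < y ->
  exists2 z, z \in `[x, y] & edot v (g y - g x) = edot v (k z) * (y - x).
Proof.
rewrite !in_itv/= => /andP[ax xb] /andP[ay yb] xy.
have cg : {within `[x, y], continuous (fun s => edot v (g s))}.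
  apply: (@continuous_subspaceW _ _ _ `[a, b]%classic).
    by apply: subset_itv; rewrite bnd_simp.
  have : {within `[a, b], continuous g}.
    exact: (difference_quotient_continuous (df:=k)) => t; exact: g_derivative.
  move=> /subspace_continuousP cg; apply/subspace_continuousP => t tab.
  exact: (cvg_comp _ _ (cg t tab) (@continuous_edot _ _ v (g t))).
have dg t : t \in `]x, y[ -> is_derive t 1 (fun s => edot v (g s)) (edot v (k t)).
  rewrite in_itv/= => /andP[xt ty]; apply: is_derive_edot.
  by rewrite in_itv/= (le_lt_trans ax xt) (lt_le_trans ty yb).
have [z zxy Ez] := MVT xy dg cg.
by exists z; [exact: subset_itv_oo_cc|rewrite edotBr].
Qed.

(** Lower bound: project the chord on its initial velocity k x. By the mean
    value theorem this projection is (y - x) <k x, k z> for some z, where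
    <k x, k z> = 1 - |k z - k x|^2 / 2 >= 1 - phi^2 / 2, and
    (1 - phi^2 / 2)^2 >= 1 - phi for phi in [0, 1]. Upper bound: project the
    chord on itself. *)
Lemma chord_bounds_lt x y e phi : x \in `[a, b] -> y \in `[a, b] ->
  (forall s t, s \in `[a, b] -> t \in `[a, b] -> `|s - t| < e ->
    enorm (k t - k s) <= phi) ->
  phi <= 1 -> `|x - y| < e -> x < y ->
  (1 - phi) * `|x - y| ^+ 2 <= enorm (g y - g x) ^+ 2 <= `|x - y| ^+ 2.
Proof.
move=> xab yab phiP phi1 xye xy; set n := enorm _.
have n0 : 0 <= n by exact: enorm_ge0.
have sub z : z \in `[x, y] -> z \in `[a, b].
  move: xab yab; rewrite !in_itv/= => /andP[ax _] /andP[_ yb] /andP[xz zy].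
  by rewrite (le_trans ax xz) (le_trans zy).
have D0 : 0 < y - x by rewrite subr_gt0.
rewrite distrC (gtr0_norm D0); apply/andP; split.
- have [z zxy Ez] := edot_MVT (k x) xab yab xy.
  have xz : `|x - z| < e.
    apply: le_lt_trans xye; move: zxy; rewrite in_itv/= => /andP[xz zy].
    by rewrite !ler0_norm ?subr_le0// ?lerN2 ?lerD2l ?lerN2// ltW.
  have kz := phiP x z xab (sub z zxy) xz.
  have k0 := enorm_ge0 (k z - k x).
  have : edot (k x) (g y - g x) <= n.
    by rewrite (le_trans (edot_le_enorm _ _))// k_unit// mul1r.
  rewrite Ez (edot_unit (k_unit xab) (k_unit (sub z zxy))) => nD.
  set m := enorm (k z - k x) in kz k0 nD.
  have m1 : 1 - phi <= (1 - m ^+ 2 / 2) ^+ 2 by nra.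
  apply: (@le_trans _ _ ((1 - m ^+ 2 / 2) ^+ 2 * (y - x) ^+ 2)).
    by rewrite ler_wpM2r// sqr_ge0.
  rewrite -exprMn ler_sqr ?nnegrE// mulr_ge0 ?(ltW D0)//; nra.
- have [z zxy Ez] := edot_MVT (g y - g x) xab yab xy.
  rewrite ler_sqr ?nnegrE ?(ltW D0)//.
  have : n ^+ 2 <= n * (y - x).
    rewrite sqr_enorm Ez ler_wpM2r ?(ltW D0)//.
    by rewrite (le_trans (edot_le_enorm _ _))// (k_unit (sub z zxy)) mulr1.
  by nra.
Qed.

Section chord.
Context (x y e phi : R).
Context (xab : x \in `[a, b]) (yab : y \in `[a, b]).
Context (xye : `|x - y| < e).
Context (phiP : forall s t, s \in `[a, b] -> t \in `[a, b] -> `|s - t| < e ->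
  enorm (k t - k s) <= phi).
Context (phi_le1 : phi <= 1).

Let chord_bounds : (1 - phi) * `|x - y| ^+ 2 <= enorm (g y - g x) ^+ 2 <= `|x - y| ^+ 2.
Proof.
have [xy|yx|xy] := ltgtP x y.
- exact: chord_bounds_lt xye xy.
- rewrite -[g y - g x]opprB enormN distrC.
  by apply: (chord_bounds_lt yab xab phiP phi_le1 _ yx); rewrite distrC.
- rewrite xy !subrr normr0 expr0n mulr0 sqr_enorm /edot big1 ?lexx// => j _.
  by rewrite mxE mul0r.
Qed.

Lemma edot_chord_le : edot (g x) (g y) <= 1 - (1 - phi) * `|x - y| ^+ 2 / 2.
Proof.
rewrite edot_unit ?g_unit// lerD2l lerN2 ler_pM2r ?invr_gt0//.
by have /andP[] := chord_bounds.
Qed.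

Lemma edot_chord_ge : 1 - `|x - y| ^+ 2 / 2 <= edot (g x) (g y).
Proof.
rewrite edot_unit ?g_unit// lerD2l lerN2 ler_pM2r ?invr_gt0//.
by have /andP[] := chord_bounds.
Qed.
End chord.

End unit_speed_curve.

(** * Integrals of bounded functions, and independence *)

(** The integral of a nonnegative function is a supremum over the simple
    functions below it, which is monotone for arbitrary functions. It will bound
    the integral of a function built from infima over all couplings. *)
Lemma ge0_le_integral_nonmeasurable d (T : measurableType d) (R : realType)
    (mu : {measure set T -> \bar R}) (f g : T -> \bar R) :
  (forall x, 0 <= f x)%E -> (forall x, f x <= g x)%E ->
  (\int[mu]_x f x <= \int[mu]_x g x)%E.
Proof.
move=> f0 fg; have g0 x : (0 <= g x)%E by exact: le_trans (f0 x) (fg x).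
rewrite !ge0_integralTE//; apply: le_ereal_sup => _ [h hf <-].
by exists h => // x; exact: le_trans (hf x) (fg x).
Qed.

Lemma measurable_bigmax d (T : measurableType d) (R : realType) (J : Type)
    (s : seq J) (f : J -> T -> R) :
  (forall j, measurable_fun setT (f j)) ->
  measurable_fun setT (fun x => \big[Num.max/0]_(j <- s) f j x).
Proof.
move=> mf; elim: s => [|j s IHs].
  by under eq_fun do rewrite big_nil; exact: measurable_cst.
by under eq_fun do rewrite big_cons; exact: measurable_maxr.
Qed.

Lemma bounded_integrable d (T : measurableType d) (R : realType)
    (mu : {measure set T -> \bar R}) (A : set T) (f : T -> R) (C : R) :
  measurable A -> (mu A < +oo)%E -> measurable_fun A f ->
  (forall x, A x -> `|f x| <= C) -> mu.-integrable A (EFin \o f).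
Proof.
move=> mA muA mf fC; apply: measurable_bounded_integrable => //.
exists C; split; first exact: num_real.
by move=> M CM x /fC /le_trans; apply; exact: ltW.
Qed.

Lemma bounded_expectation_integrable d (T : measurableType d) (R : realType)
    (P : probability T R) (f : T -> R) (C : R) :
  measurable_fun setT f -> (forall x, `|f x| <= C) ->
  P.-integrable setT (EFin \o f).
Proof.
move=> mf fC; apply: (@bounded_integrable _ _ _ _ _ _ C) => //.
exact: le_lt_trans (probability_le1 P measurableT) (ltry _).
Qed.

Section independence.
Context d (T : measurableType d) (R : realType) (P : probability T R).
Context d1 (T1 : measurableType d1) d2 (T2 : measurableType d2).

(** Measurability of partial integrals is a by-product of Fubini's theorem for a
    product measure; any probability can play the part of the first factor, and
    a Dirac mass always exists. *)
Lemma measurable_expectation (f : T1 * T -> R) (C : R) :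
  measurable_fun setT f -> (forall z, `|f z| <= C) ->
  measurable_fun setT (fun x => \int[P]_w (f (x, w))%:E)%E.
Proof.
move=> mf fC.
have fin : (((\d_(point : T1) : probability T1 R) \x P) setT < +oo)%E.
  by rewrite -setXTT product_measure1E//= diracT probability_setT mul1e ltry.
have intf : ((\d_(point : T1) : probability T1 R) \x P)%E.-integrable setT
    (fun z => (f z)%:E).
  exact: (@bounded_integrable _ _ _ _ _ f C).
exact: (measurable_fubini_F intf).
Qed.

(** Independence says that the joint law of (X, Y) agrees with the product of
    the laws on rectangles, hence everywhere; what follows is Fubini's theorem. *)
Lemma integral_independent (X : {RV P >-> T1}) (Y : T -> T2)
    (f : T1 * T2 -> R) (C : R) :
  measurable_fun setT Y ->
  (forall A B, measurable A -> measurable B ->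
     P (X @^-1` A `&` Y @^-1` B) = P (X @^-1` A) * P (Y @^-1` B))%E ->
  measurable_fun setT f -> (forall z, `|f z| <= C) ->
  (\int[P]_w (f (X w, Y w))%:E =
   \int[distribution P X]_x \int[P]_w (f (x, Y w))%:E)%E.
Proof.
move=> mY XY mf fC.
pose Y' : {RV P >-> T2} := mfun_Sub (mem_set mY).
have mXY : measurable_fun setT (fun w => (X w, Y w)).
  exact: measurable_fun_pair.
pose XY' : {RV P >-> (T1 * T2)%type} := mfun_Sub (mem_set mXY).
have mEf : measurable_fun setT (fun z => (f z)%:E) by exact/measurable_EFinP.
transitivity (\int[distribution P XY']_z (f z)%:E)%E.
  rewrite (@integral_distribution _ _ _ _ _ P XY' (fun z => (f z)%:E))//.
  apply: (@bounded_expectation_integrable _ _ _ _ (fun w => f (X w, Y w)) C).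
    exact: measurableT_comp.
  by move=> w; exact: fC.
have XYE A : measurable A ->
    (distribution P X \x distribution P Y')%E A = distribution P XY' A.
  by move=> mA; apply: product_measure_unique => // B1 B2 mB1 mB2; exact: XY.
have fin : ((distribution P X \x distribution P Y')%E setT < +oo)%E.
  by rewrite XYE// probability_setT ltry.
have intf : (distribution P X \x distribution P Y')%E.-integrable setT
    (fun z => (f z)%:E).
  exact: (@bounded_integrable _ _ _ _ _ f C).
transitivity (\int[(distribution P X \x distribution P Y')%E]_z (f z)%:E)%E.
  by apply: eq_measure_integral => A mA _; apply/esym/XYE.
rewrite -integral12_prod_meas1//; apply: eq_integral => x _; rewrite /fubini_F.
have mfx : measurable_fun setT (fun y => f (x, y)).
  by apply: measurableT_comp => //; exact: measurable_fun_pair.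
rewrite (@integral_distribution _ _ _ _ _ P Y' (fun y => (f (x, y))%:E))//.
  exact/measurable_EFinP.
apply: (@bounded_expectation_integrable _ _ _ _ (fun w => f (x, Y w)) C) => [|w].
  by apply: (measurableT_comp mfx).
exact: fC.
Qed.

End independence.

(** The uniform law lives on a copy of the line with another measurable-space
    structure, which has the same measurable sets; the identity is used as a
    random variable to carry integrals across. *)
Lemma ge0_integral_uniform01 (R : realType) (m : {measure set R -> \bar R})
    (f : R -> \bar R) :
  (forall A, measurable A -> m A = uniform_prob (@ltr01 R) A) ->
  measurable_fun setT f -> (forall x, 0 <= f x)%E ->
  (\int[m]_x f x = \int[lebesgue_measure]_(x in `[0%R, 1%R]) f x)%E.
Proof.
move=> mE mf f0.
pose idR : measurableTypeR R -> R := id.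
have midR : measurable_fun setT idR by move=> _ A mA; rewrite setTI.
pose idRV : {RV uniform_prob (@ltr01 R) >-> R} := mfun_Sub (mem_set midR).
transitivity (\int[distribution (uniform_prob (@ltr01 R)) idRV]_x f x)%E.
  by apply: eq_measure_integral => A mA _; exact: mE.
rewrite ge0_integral_distribution// integral_uniform// subr0 invr1 mul1e.
exact: eq_integral.
Qed.

Lemma integral_uniform01 (R : realType) (m : {measure set R -> \bar R})
    (f : R -> \bar R) :
  (forall A, measurable A -> m A = uniform_prob (@ltr01 R) A) ->
  measurable_fun setT f ->
  (\int[m]_x f x = \int[lebesgue_measure]_(x in `[0%R, 1%R]) f x)%E.
Proof.
move=> mE mf; rewrite [LHS]integralE [RHS]integralE.
rewrite !(ge0_integral_uniform01 mE)//.
  exact: measurable_funeneg.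
exact: measurable_funepos.
Qed.

(** Both sides are finite measures in A, so agreement on a pi-system extends to
    the sigma-algebra it generates. *)
Lemma independent_g_sigma d (T : measurableType d) (R : realType)
    (P : probability T R) (G : set (set T)) (B : set T) :
  G `<=` measurable -> setI_closed G -> G setT -> measurable B ->
  (forall A, G A -> P (A `&` B) = P A * P B)%E ->
  forall A, <<s G >> A -> P (A `&` B) = (P A * P B)%E.
Proof.
move=> Gm GI GT mB GB A sA.
pose pB : {nonneg R} := NngNum (fine_ge0 (measure_ge0 P B)).
pose m1 : {measure set T -> \bar R} := mrestr P mB.
pose m2 : {measure set T -> \bar R} := mscale pB P.
have m2E A' : m2 A' = (P A' * P B)%E.
  by rewrite /m2/= /mscale/= fineK ?fin_num_measure// muleC.
rewrite -m2E -[LHS]/(m1 A).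
apply: (@g_sigma_algebra_measure_unique _ _ _ G Gm (fun=> setT)) => //.
- by apply/seteqP; split => // x _; exists 0%N.
- by move=> A' GA'; rewrite m2E; exact: GB.
- move=> _; rewrite /m1/= /mrestr setTI (le_lt_trans (probability_le1 _ mB))//.
  exact: ltry.
Qed.

Section collection_sigma_algebra.
Context d (T : measurableType d) (R : realType).

(** The events that depend on one member of the collection. Seen through the
    type they generate, a function of the whole collection is a function on the
    sample space itself, measurable for a coarser sigma-algebra; no space of
    tuples is involved. *)
Definition collection_sets n (X : 'I_n -> T -> measurableTypeR R) : set (set T) :=
  \big[setU/set0]_(i < n) preimage_set_system setT (X i) measurable.

Lemma measurable_collection n (X : 'I_n -> T -> measurableTypeR R) i :
  measurable_fun (setT : set (g_sigma_algebraType (collection_sets X))) (X i).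
Proof.
move=> _ A mA; apply: sub_sigma_algebra.
rewrite /collection_sets (bigD1 i)//=; left.
by exists A.
Qed.
Lemma measurable_id_collection n (X : 'I_n -> T -> R) :
  (forall i, measurable_fun setT (X i)) ->
  measurable_fun setT (id : T -> g_sigma_algebraType (collection_sets X)).
Proof.
move=> mX _ A mA; rewrite setTI.
apply: (smallest_sub _ _ mA); first exact: sigma_algebra_measurable.
rewrite /collection_sets; elim/big_ind: _ => [//|D E sD sE A' []|i _ _ [D mD <-]].
- exact: sD.
- exact: sE.
exact: mX.
Qed.

End collection_sigma_algebra.

Section iid.
Context d (T : measurableType d) (R : realType) (P : probability T R).

Lemma widen_ordE n (i : 'I_n) : widen_ord (leqnSn n) i = lift ord_max i.
Proof. by apply/val_inj/esym/lift_max. Qed.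

Let init n (X : 'I_n.+1 -> {RV P >-> R}) (i : 'I_n) := X (widen_ord (leqnSn n) i).

Lemma mutually_independent_rcons n (X : 'I_n.+1 -> {RV P >-> R})
    (A : 'I_n -> set (measurableTypeR R)) (B : set (measurableTypeR R)) :
  mutually_independent X -> (forall i, measurable (A i)) -> measurable B ->
  (P ((\bigcap_i (init X i @^-1` A i)) `&` X ord_max @^-1` B) =
   \prod_(i < n) P (init X i @^-1` A i) * P (X ord_max @^-1` B))%E.
Proof.
move=> indX mA mB.
(* The family A extended by B at the last index. *)
pose AB i := if unlift ord_max i is Some j then A j else B.
have ABl i : AB (lift ord_max i) = A i by rewrite /AB liftK.
have ABm : AB ord_max = B by rewrite /AB unlift_none.
have /indX : forall i, measurable (AB i).
  by move=> i; rewrite /AB; case: unliftP.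
rewrite big_ord_recr/= ABm; under eq_bigr do rewrite widen_ordE ABl -widen_ordE.
move=> <-; congr (P _); apply/seteqP; split => [w [Aw Bw] i _ /=|w ABw].
  have [j ->|->] := unliftP ord_max i; last by rewrite ABm.
  by rewrite ABl -widen_ordE; exact: Aw.
split; last by have := ABw ord_max I; rewrite ABm.
by move=> i _; have := ABw (lift ord_max i) I; rewrite /= ABl /init widen_ordE.
Qed.

Lemma mutually_independent_init n (X : 'I_n.+1 -> {RV P >-> R}) :
  mutually_independent X -> mutually_independent (init X).
Proof.
move=> indX B mB.
have := mutually_independent_rcons indX mB (@measurableT _ _).
by rewrite preimage_setT probability_setT mule1 setIT.
Qed.

(** The events depending on all variables but the last are generated by the
    finite intersections of preimages, for which the product rule is the
    definition of mutual independence. *)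
Lemma mutually_independent_last n (X : 'I_n.+1 -> {RV P >-> R})
    (A : set T) (B : set (measurableTypeR R)) :
  mutually_independent X -> g_sigma_preimage (init X) A -> measurable B ->
  P (A `&` X ord_max @^-1` B) = (P A * P (X ord_max @^-1` B))%E.
Proof.
move=> indX sA mB.
pose G := [set A' | exists2 C : 'I_n -> set (measurableTypeR R),
  forall i, measurable (C i) & A' = \bigcap_i (init X i @^-1` C i)].
have mX i (C : set (measurableTypeR R)) : measurable C -> measurable (X i @^-1` C).
  by move=> mC; rewrite -[X in measurable X]setTI; exact: measurable_funPT.
apply: (@independent_g_sigma _ _ _ P G (X ord_max @^-1` B)) => //.
- move=> _ [C mC ->]; apply: fin_bigcap_measurable => // i _; exact: mX.
- move=> _ _ [C mC ->] [D mD ->]; exists (fun i => C i `&` D i).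
    by move=> i; exact: measurableI.
  rewrite -bigcapI; apply: eq_bigcapr => i _; by rewrite preimage_setI.
- exists (fun=> setT) => //.
  by apply/seteqP; split.
- exact: mX.
- move=> _ [C mC ->]; rewrite mutually_independent_rcons//.
  by rewrite (mutually_independent_init indX).
apply: (smallest_sub _ _ sA); first exact: smallest_sigma_algebra.
elim/big_ind: _ => [//|C D sC sD A' []|i _ _ [C mC <-]]; [exact: sC|exact: sD|].
apply: sub_sigma_algebra; exists (fun j => if j == i then C else setT).
  by move=> j; case: ifP.
apply/seteqP; split => [w [_ Cw] j _|w /(_ i I)/=]; last by rewrite eqxx.
by rewrite /=; case: eqVneq => [->|].
Qed.
End iid.

(** * Iterated integrals as expectations over ordered uniform samples *)

Lemma mutually_independent_perm d (T : measurableType d) (R : realType)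
    (P : probability T R) n (X : 'I_n -> {RV P >-> R}) (s : 'S_n) :
  mutually_independent X -> mutually_independent (X \o s).
Proof.
move=> indX B mB.
have := indX (fun i => B (s^-1 i)%g) (fun i => mB _).
rewrite [in RHS](reindex_perm s)/=; under [in RHS]eq_bigr do rewrite permK.
move=> <-; congr (P _); apply/seteqP; split => w Bw i _.
  by have /= := Bw ((s^-1)%g i) I; rewrite permKV.
by have /= := Bw (s i) I; rewrite permK.
Qed.

Section chain_weight.
Context (R : realType) (d : nat) (dx : R -> 'rV[R]_d).

(** The integrand over ordered samples: the product of the coordinates
    dx (u i) 0 (I i) if u 0 <= ... <= u (n-1) <= t, and 0 otherwise
    ([chain_weightE]). The recursion is that of [iterated_integral], so that the
    two can be compared by induction. *)
Fixpoint chain_weight n : ('I_n -> 'I_d) -> ('I_n -> R) -> R -> R :=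
  match n with
  | 0 => fun _ _ _ => 1
  | m.+1 => fun I u t =>
      if u ord_max <= t then
        chain_weight (fun i => I (widen_ord (leqnSn m) i))
          (fun i => u (widen_ord (leqnSn m) i)) (u ord_max)
        * dx (u ord_max) 0 (I ord_max)
      else 0
  end.

Context (mdx : forall j, measurable_fun setT (fun s => dx s 0 j)).
Context (C : R) (dxC : forall s j, `|dx s 0 j| <= C).

Lemma measurable_chain_weight disp (S : measurableType disp) n
    (I : 'I_n -> 'I_d) (u : 'I_n -> S -> R) (t : S -> R) :
  (forall i, measurable_fun setT (u i)) -> measurable_fun setT t ->
  measurable_fun setT (fun x => chain_weight I (u^~ x) (t x)).
Proof.
elim: n I u t => [|n IHn] I u t mu mt /=; first exact: measurable_cst.
apply: measurable_fun_ifT => //.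
- exact: measurable_fun_ler.
- apply: measurable_funM; last exact: (measurableT_comp (mdx _)).
  exact: (IHn _ (fun i => u (widen_ord (leqnSn n) i))).
Qed.

Lemma chain_weight_bounded n (I : 'I_n -> 'I_d) (u : 'I_n -> R) (t : R) :
  `|chain_weight I u t| <= C ^+ n.
Proof.
elim: n I u t => [|n IHn] I u t /=; first by rewrite normr1.
have C0 : 0 <= C by apply: le_trans (dxC 0 (I ord_max)).
case: ifP => _; last by rewrite normr0 exprn_ge0.
by rewrite normrM exprSr ler_pM.
Qed.

Context disp (T : measurableType disp) (P : probability T R).

(** By independence the last variable, which carries the largest time, can be
    integrated last; inside, the induction hypothesis applies with the bound t
    replaced by its value. The minimum with 1 accounts for the variables being
    at most 1 almost surely. *)
Lemma expectation_chain_weight n (I : 'I_n -> 'I_d) (U : 'I_n -> {RV P >-> R})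
    (t : R) : iid_uniform01 U -> 0 <= t ->
  (\int[P]_w (chain_weight I (U^~ w) t)%:E =
   (iterated_integral dx I (Num.min t 1))%:E)%E.
Proof.
elim: n I U t => [|n IHn] I U t [indU uU] t0 /=.
  by rewrite integral_cst// mul1e; exact: probability_setT.
set U' := fun i : 'I_n => U (widen_ord (leqnSn n) i).
set I' := fun i : 'I_n => I (widen_ord (leqnSn n) i).
have iidU' : iid_uniform01 U'.
  by split; [exact: mutually_independent_init|move=> i; exact: uU].
(* The sample space, with only the events that depend on the first n variables. *)
pose T' := g_sigma_algebraType (collection_sets (fun i => U' i : T -> R)).
pose f (z : R * T') : R := if z.1 <= t then
  chain_weight I' (U'^~ z.2) z.1 * dx z.1 0 (I ord_max) else 0.
have mf : measurable_fun setT f.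
  apply: measurable_fun_ifT => //.
    exact: measurable_fun_ler.
  apply: measurable_funM; last exact: (measurableT_comp (mdx _)).
  apply: (@measurable_chain_weight _ (R * T')%type n I' (fun i z => U' i z.2)) => // i.
  by apply: (measurableT_comp (measurable_collection (X:=fun i => U' i : T -> R) i)).
have C0 : 0 <= C by apply: le_trans (dxC 0 (I ord_max)).
have fC z : `|f z| <= C ^+ n.+1.
  rewrite /f; case: ifP => _; last by rewrite normr0 exprn_ge0.
  by rewrite normrM exprSr ler_pM// chain_weight_bounded.
have mid : measurable_fun setT (id : T -> T').
  exact: (@measurable_id_collection _ T R n (fun i => U' i : T -> R)).
transitivity (\int[P]_w (f (U ord_max w, (w : T')))%:E)%E; first by [].
have fin : (\int[P]_w (f (U ord_max w, (w : T')))%:E)%E \is a fin_num.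
  apply: integrable_fin_num => //.
  apply: (@bounded_expectation_integrable _ _ _ _ _ (C ^+ n.+1)) => //.
  apply: (measurableT_comp mf); exact: measurable_fun_pair.
rewrite -(fineK fin); congr EFin; rewrite /Rintegral; congr fine.
rewrite (@integral_independent _ T R P _ R _ T' (U ord_max) id f (C ^+ n.+1))//;
    last first.
  move=> A B mA mB; rewrite setIC muleC.
  exact: mutually_independent_last.
rewrite integral_uniform01; last 2 first.
  by move=> A mA; exact: uU.
  have mz : measurable_fun setT (fun z : R * T => (z.1, (z.2 : T'))).
    apply: (measurable_fun_pair measurable_fst).
    exact: (measurableT_comp mid measurable_snd).
  exact: (@measurable_expectation _ T R P _ R _ (C ^+ n.+1)
    (measurableT_comp mf mz) (fun z => fC _)).
rewrite [RHS]integral_mkcond [LHS]integral_mkcond; apply: eq_integral => x _.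
rewrite !patchE !mem_setE/= !in_itv/= le_min; case: ifPn => [/andP[x0 x1]|]; last first.
  by case: (0 <= x) => //= /negPf ->; rewrite andbF.
rewrite x0 x1 andbT/= /f/=; case: ifPn => xt; last by rewrite integral0.
under eq_integral do rewrite EFinM.
rewrite integralZr//; last first.
  apply: (@bounded_expectation_integrable _ _ _ _ _ (C ^+ n)) => [|w].
    apply: (@measurable_chain_weight _ T n I' U' (fun=> x)) => //.
  exact: chain_weight_bounded.
by rewrite IHn// EFinM (min_idPl x1).
Qed.
End chain_weight.

Lemma eq_iterated_integral (R : realType) d (dx dy : R -> 'rV[R]_d) n
    (I : 'I_n -> 'I_d) (c t : R) :
  (forall s, 0 <= s <= c -> dx s = dy s) -> t <= c ->
  iterated_integral dx I t = iterated_integral dy I t.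
Proof.
move=> dxy; elim: n I t => [//|n IHn] I t tc /=.
apply: eq_Rintegral => s; rewrite inE/= in_itv/= => /andP[s0 st].
by rewrite IHn ?dxy ?s0 ?(le_trans st tc).
Qed.

Lemma is_derive_monomial (R : realType) n (c s : R) :
  is_derive s 1 (fun s : R => s ^+ n.+1 / c) (n.+1%:R * s ^+ n / c).
Proof.
have -> : (fun s : R => s ^+ n.+1 / c) = c^-1 \*: (@GRing.exp R ^~ n.+1).
  by apply/funext => x; rewrite mulrC.
have dX : is_derive s 1 (@GRing.exp R ^~ n.+1) (n.+1%:R * s ^+ n).
  apply: DeriveDef; first exact: exprn_derivable.
  by rewrite exp_derive/= /GRing.scale/= mulr1.
have := is_deriveZ c^-1 dX; rewrite /GRing.scale/= => dZ.
by rewrite mulrC.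
Qed.

(** The volume of the simplex: with a constant velocity the signature terms are
    t^n / n!. *)
Lemma iterated_integral_cst1 (R : realType) n (I : 'I_n -> 'I_1) (t : R) :
  0 <= t -> iterated_integral (fun=> const_mx 1) I t = t ^+ n / n`!%:R.
Proof.
elim: n I t => [|n IHn] I t t0 /=; first by rewrite expr0 fact0 divr1.
set J := fun i => I _.
transitivity (\int[lebesgue_measure]_(s in `[0, t]) (s ^+ n / n`!%:R)).
  apply: eq_Rintegral => s; rewrite inE/= in_itv/= => /andP[s0 _].
  by rewrite IHn// mxE mulr1.
move: t0; rewrite le_eqVlt => /predU1P[<-|t0].
  by rewrite set_itv1 Rintegral_set1 expr0n mul0r.
pose F s : R := s ^+ n.+1 / n.+1`!%:R.
have dF (s : R) : is_derive s 1 F (s ^+ n / n`!%:R).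
  have := is_derive_monomial n n.+1`!%:R s.
  rewrite -/F factS natrM invfM mulrCA mulrA mulrA mulVf ?pnatr_eq0// mul1r mulrC.
  by [].
have cF : continuous (F : R -> R).
  by move=> s; apply/differentiable_continuous/derivable1_diffP; exact: ex_derive.
rewrite /Rintegral (@continuous_FTC2 _ _ F)//=.
- by rewrite /F expr0n/= mul0r subr0.
- by apply: continuous_subspaceT => x; apply: cvgMl; exact: exprn_continuous.
- split.
  + by move=> x _; exact: ex_derive.
  + exact/cvg_at_right_filter/cF.
  + exact/cvg_at_left_filter/cF.
- by move=> x _; rewrite derive1E derive_val.
Qed.

(** * Order statistics *)

Lemma sorted_rcons_le (R : realType) (r : seq R) (t : R) :
  sorted <=%R r -> all (<= t) r -> sorted <=%R (rcons r t).
Proof.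
case: r => //= x r xr /andP[xt rt]; rewrite rcons_path xr/=.
have := mem_last x r; rewrite inE => /predU1P[->//|].
by move: rt => /allP; exact.
Qed.

Section sorting.
Context (R : realType) (d : nat) (dx : R -> 'rV[R]_d).

Lemma chain_weightE n (I : 'I_n -> 'I_d) (u : 'I_n -> R) (t : R) :
  chain_weight dx I u t =
  if sorted <=%R (rcons [seq u i | i <- enum 'I_n] t)
  then \prod_(i < n) dx (u i) 0 (I i) else 0.
Proof.
elim: n I u t => [|n IHn] I u t /=.
  by rewrite big_ord0 (_ : enum _ = [::])//; apply/nilP; rewrite /nilp size_enum_ord.
have srr (r : seq R) x y : sorted <=%R (rcons (rcons r x) y) =
    sorted <=%R (rcons r x) && (x <= y).
  by case: r => [|z r] /=; rewrite ?andbT// rcons_path last_rcons.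
rewrite enum_ordSr map_rcons srr -map_comp big_ord_recr/= IHn.
rewrite -/([seq u (widen_ord (leqnSn n) i) | i <- enum 'I_n]).
by case: ifP => _; rewrite ?andbT ?andbF//; case: ifP; rewrite ?mul0r.
Qed.

(** Any permutation that sorts the sample yields the order statistics; with ties
    there are several such permutations. *)
Lemma order_stat_sorted disp (T : measurableType disp) n (U : 'I_n -> T -> R)
    (s : 'S_n) (w : T) (i : 'I_n) :
  sorted <=%R [seq U (s j) w | j <- enum 'I_n] -> order_stat U i w = U (s i) w.
Proof.
move=> us; rewrite /order_stat.
have -> : sort <=%R [seq U j w | j <- enum 'I_n] = [seq U (s j) w | j <- enum 'I_n].
  rewrite -[RHS](sorted_sort le_trans us); apply/perm_sortP.
  - exact: le_total.
  - exact: le_trans.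
  - exact: le_anti.
  rewrite (map_comp (fun j => U j w) s); apply: perm_map; rewrite perm_sym.
  apply: uniq_perm; first by rewrite map_inj_uniq ?enum_uniq//; exact: perm_inj.
    exact: enum_uniq.
  move=> j; rewrite mem_enum; apply/mapP; exists ((s^-1)%g j).
    by rewrite mem_enum.
  by rewrite permKV.
rewrite (nth_map i) ?size_enum_ord//.
by rewrite nth_ord_enum.
Qed.

Lemma exists_sorting_perm n (u : 'I_n -> R) :
  exists s : 'S_n, sorted <=%R [seq u (s j) | j <- enum 'I_n].
Proof.
have /tuple_permP[s us] : perm_eq (sort <=%R [seq u j | j <- enum 'I_n])
    (map_tuple u (ord_tuple n)).
  by rewrite perm_sort.
exists s.
suff <- : sort <=%R [seq u j | j <- enum 'I_n] = [seq u (s j) | j <- enum 'I_n].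
  by apply: sort_sorted; exact: le_total.
rewrite us; apply: eq_map => j /=.
by rewrite tnth_map tnth_ord_tuple.
Qed.

(** The k-th smallest value is at most c exactly when more than k values are
    (k counting from 0). This makes order statistics measurable without
    choosing a sorting permutation measurably. *)
Lemma order_stat_le disp (T : measurableType disp) n (U : 'I_n -> T -> R)
    (k : 'I_n) (w : T) (c : R) :
  (order_stat U k w <= c) = (k < \sum_(i < n) (U i w <= c)%R)%N.
Proof.
rewrite /order_stat; set r := [seq U i w | i <- enum 'I_n].
have rs : sorted <=%R (sort <=%R r) by apply: sort_sorted; exact: le_total.
have -> : (\sum_(i < n) (U i w <= c)%R)%N = count (<= c) (sort <=%R r).
  rewrite count_sort count_map -sum1_count [RHS]big_enum_cond/= [RHS]big_mkcond.
  by apply: eq_bigr => i _; case: (_ <= _).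

apply/idP/idP; last exact: nth_count_le.
apply: contraTT; rewrite -leqNgt -ltNge => ck.
by apply: nth_count_gt => //; rewrite ck size_sort size_map size_enum_ord/=.
Qed.

Lemma measurable_order_stat disp (T : measurableType disp) n
    (U : 'I_n -> T -> R) (k : 'I_n) :
  (forall i, measurable_fun setT (U i)) -> measurable_fun setT (order_stat U k).
Proof.
move=> mU; apply: (measurability _ (RGenOInfty.measurableE R)).
move=> _ [_ [c ->] <-]; rewrite setTI.
pose N w : R := \sum_(i < n) (U i w <= c)%R%:R.
have -> : order_stat U k @^-1` `]c, +oo[ = N @^-1` `]-oo, k%:R].
  apply/seteqP; split => w; rewrite /= !in_itv/= andbT ltNge order_stat_le.
    by rewrite -leqNgt -(ler_nat R) natr_sum.
  by rewrite -leqNgt -(ler_nat R) natr_sum.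
rewrite -[X in measurable X]setTI.
suff mN : measurable_fun setT N by exact: mN.
apply: measurable_sum => i.
have -> : (fun w => (U i w <= c)%R%:R) = (fun w => if U i w <= c then 1 else 0 : R).
  by apply/funext => w; case: ifP.
by apply: measurable_fun_ifT => //; exact: measurable_fun_ler.
Qed.

End sorting.

Section expectation.
Context (R : realType) (d : nat) (dx : R -> 'rV[R]_d).
Context (mdx : forall j, measurable_fun setT (fun s => dx s 0 j)).
Context (C : R) (dxC : forall s j, `|dx s 0 j| <= C).
Context disp (T : measurableType disp) (P : probability T R).

Lemma iid_uniform01_perm n (U : 'I_n -> {RV P >-> R}) (s : 'S_n) :
  iid_uniform01 U -> iid_uniform01 (U \o s).
Proof.
by case=> indU uU; split; [exact: mutually_independent_perm|move=> i; exact: uU].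
Qed.

Lemma ae_uniform01_le1 n (U : 'I_n -> {RV P >-> R}) :
  iid_uniform01 U -> {ae P, forall w, forall i, U i w <= 1}.
Proof.
case=> _ uU; apply: filter_forall => i.
exists (U i @^-1` `]1, +oo[); split.
- by rewrite -[X in measurable X]setTI; apply: measurable_funP.
- have := uU i `]1, +oo[%classic (measurable_itv _).
  rewrite /distribution/= /pushforward => ->.
  rewrite /uniform_prob integral_uniform_pdf (_ : _ `&` _ = set0) ?integral_set0//.
  apply/seteqP; split => // x [] /=; rewrite !in_itv/= andbT => x1 /andP[_].
  by rewrite leNgt x1.
- by move=> w /= /negP; rewrite in_itv/= andbT ltNge.
Qed.

(** Sum the chain weights over all permutations of the sample: every
    permutation that sorts it contributes the same product, so the sum is N
    times the product, N being the number of sorting permutations. Applied to a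
    constant velocity, the same sum shows that E N = n! / n! = 1; as N >= 1
    almost surely, N = 1 almost surely. Thus ties are negligible, without any
    computation of the probability of a tie. *)
Lemma expectation_order_stat n (I : 'I_n -> 'I_d) (U : 'I_n -> {RV P >-> R}) :
  iid_uniform01 U ->
  (\int[P]_w (\prod_(i < n) dx (order_stat U i w) 0 (I i))%:E =
   (n`!%:R * iterated_integral dx I 1)%:E)%E.
Proof.
move=> iidU.
(* With this one-dimensional velocity the chain weight is the indicator of the
   chain, and N counts the sorting permutations. *)
pose one : R -> 'rV[R]_1 := fun=> const_mx 1.
pose N w := \sum_(s : 'S_n) chain_weight one (fun=> ord0) (fun i => U (s i) w) 1.
pose Pi w := \prod_(i < n) dx (order_stat U i w) 0 (I i).
have NPi w : N w * Pi w = \sum_(s : 'S_n) chain_weight dx I (fun i => U (s i) w) 1.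
  rewrite /N mulr_suml; apply: eq_bigr => s _; rewrite !chain_weightE.
  case: ifPn => [us|_]; last by rewrite mul0r.
  rewrite big1 ?mul1r => [|i _]; last by rewrite mxE.
  apply: eq_bigr => i _; rewrite (@order_stat_sorted _ _ _ _ _ s)//.
  by apply: subseq_sorted us; [exact: le_trans|exact: subseq_rcons].
have N1 w : (forall i, U i w <= 1) -> 1 <= N w.
  move=> U1; have [s us] := exists_sorting_perm (fun i => U i w).
  rewrite /N (bigD1 s)//= chain_weightE.
  have -> : sorted <=%R (rcons [seq U (s i) w | i <- enum 'I_n] 1).
    by apply: sorted_rcons_le us _; apply/allP => _ /mapP[i _ ->]; exact: U1.
  rewrite big1 => [|i _]; last by rewrite mxE.
  rewrite lerDl sumr_ge0// => s' _; rewrite chain_weightE; case: ifP => // _.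
  by rewrite prodr_ge0// => i _; rewrite mxE.
have mone j : measurable_fun setT (fun s => one s 0 j).
  by under eq_fun do rewrite mxE; exact: measurable_cst.
have oneC s j : `|one s 0 j| <= 1 by rewrite mxE normr1.
have mU (s : 'S_n) i : measurable_fun setT (U (s i) : T -> R) by [].
have int1 (s : 'S_n) : P.-integrable setT
    (fun w => (chain_weight one (fun=> ord0) (fun i => U (s i) w) 1)%:E).
  apply: (@bounded_expectation_integrable _ _ _ _ _ (1 ^+ n)) => [|w].
    exact: (@measurable_chain_weight _ _ _ mone _ T n (fun=> ord0)
      (fun i => U (s i)) (fun=> 1) (mU s) (measurable_cst _)).
  exact: chain_weight_bounded.
have intI (s : 'S_n) : P.-integrable setT
    (fun w => (chain_weight dx I (fun i => U (s i) w) 1)%:E).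
  apply: (@bounded_expectation_integrable _ _ _ _ _ (C ^+ n)) => [|w].
    exact: (@measurable_chain_weight _ _ _ mdx _ T n I
      (fun i => U (s i)) (fun=> 1) (mU s) (measurable_cst _)).
  exact: chain_weight_bounded.
have cSn : #|(xpredT : pred 'S_n)| = n`!.
  by rewrite -[RHS]card_Sn; exact: eq_card.
have EN : (\int[P]_w (N w)%:E = 1)%E.
  under eq_integral do rewrite /N -sumEFin.
  rewrite integral_sum//.
  under eq_bigr => s _.
    rewrite (@expectation_chain_weight _ _ _ mone 1 oneC _ _ P n (fun=> ord0)
      (U \o s) 1 (iid_uniform01_perm s iidU) ler01).
    rewrite minxx iterated_integral_cst1// expr1n mul1r.
    over.
  rewrite sumEFin sumr_const cSn -(mulr_natl n`!%:R^-1) mulfV//.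
have mN : measurable_fun setT N.
  by apply: measurable_sum => s; exact/measurable_EFinP/measurable_int/(int1 s).
have mPi : measurable_fun setT Pi.
  apply: measurable_prod => i _; apply: (measurableT_comp (mdx _)).
  exact: measurable_order_stat.
have NE : ae_eq P setT (fun w => (N w - 1)%:E) (cst 0%E).
  apply/ae_eq_integral_abs => //.
    by apply/measurable_EFinP; apply: measurable_funB.
  transitivity (\int[P]_w ((N w)%:E - 1%:E))%E.
    apply: ae_eq_integral => //.
    - by apply: measurableT_comp => //; apply/measurable_EFinP; exact: measurable_funB.
    - by apply/measurable_EFinP; exact: measurable_funB.
    - apply: filterS (ae_uniform01_le1 iidU) => w U1 _.
      by rewrite gee0_abs// lee_fin subr_ge0; exact: N1.
  rewrite integralB//.
  - have -> : (\int[P]_w 1%:E = 1%:E)%E.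
      by rewrite integral_cst// mul1e; exact: probability_setT.
    by rewrite EN subee.
  - under eq_fun do rewrite /N -sumEFin.
    exact: integrable_sum.
  - exact: finite_measure_integrable_cst.
transitivity (\int[P]_w (N w * Pi w)%:E)%E.
  apply: ae_eq_integral => //.
  - exact/measurable_EFinP.
  - by apply/measurable_EFinP; exact: measurable_funM.
  - apply: filterS NE => w /(_ Logic.I) [/eqP]; rewrite subr_eq0 => /eqP -> _.
    by rewrite mul1r.
under eq_integral do rewrite NPi -sumEFin.
rewrite integral_sum//.
under eq_bigr => s _.
  rewrite (@expectation_chain_weight _ _ _ mdx C dxC _ _ P n I
    (U \o s) 1 (iid_uniform01_perm s iidU) ler01).
  rewrite minxx; over.
by rewrite sumEFin sumr_const cSn -(mulr_natl (iterated_integral dx I 1)).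
Qed.
End expectation.

Section product_of_order_statistics.
Context (R : realType) (d : nat) (dx : R -> 'rV[R]_d).
Context (mdx : forall j, measurable_fun setT (fun s => dx s 0 j)).
Context (C : R) (dxC : forall s j, `|dx s 0 j| <= C).
Context disp (T : measurableType disp) (P : probability T R).

(** Fubini's theorem, the two factors being functions on the sample space
    equipped with the sigma-algebras of the two collections. *)
Lemma expectation_mul_independent n (X Y : 'I_n -> T -> R) (f g : T -> R) (M : R) :
  (forall i, measurable_fun setT (X i)) ->
  (forall i, measurable_fun setT (Y i)) ->
  independent_collections P (X : 'I_n -> T -> measurableTypeR R)
                            (Y : 'I_n -> T -> measurableTypeR R) ->
  measurable_fun (setT : set (g_sigma_algebraType (collection_sets X))) f ->
  measurable_fun (setT : set (g_sigma_algebraType (collection_sets Y))) g ->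
  (forall w, `|f w| <= M) -> (forall w, `|g w| <= M) ->
  (\int[P]_w (f w * g w)%:E = \int[P]_w (f w)%:E * \int[P]_w (g w)%:E)%E.
Proof.
move=> mX mY indXY mf mg fM gM.
have M0 : 0 <= M by apply: le_trans (fM point).
pose TX := g_sigma_algebraType (collection_sets X).
pose TY := g_sigma_algebraType (collection_sets Y).
pose idX : {RV P >-> TX} := mfun_Sub (mem_set (measurable_id_collection mX)).
have midY := measurable_id_collection mY.
pose fg (z : TX * TY) : R := f z.1 * g z.2.
have mfg : measurable_fun setT fg.
  apply: measurable_funM; first exact: (measurableT_comp mf).
  exact: (measurableT_comp mg).
have fgM z : `|fg z| <= M * M by rewrite normrM ler_pM.
transitivity (\int[P]_w (fg (idX w, (w : TY)))%:E)%E; first by [].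
rewrite (@integral_independent _ T R P _ TX _ TY idX id fg (M * M))//.
have intf : P.-integrable setT (EFin \o f).
  apply: (@bounded_expectation_integrable _ _ _ _ _ M) => //.
  exact: (measurableT_comp mf (measurable_id_collection mX)).
have intg : P.-integrable setT (EFin \o g).
  apply: (@bounded_expectation_integrable _ _ _ _ _ M) => //.
  exact: (measurableT_comp mg midY).
pose b := fine (\int[P]_w (g w)%:E)%E.
have bE : (\int[P]_w (g w)%:E = b%:E)%E by rewrite fineK//; exact: integrable_fin_num.
rewrite bE -integralZr//.
transitivity (\int[distribution P idX]_x ((f x)%:E * b%:E))%E.
  apply: eq_integral => x _; rewrite /fg/=.
  under eq_integral do rewrite EFinM.
  by rewrite integralZl// bE.
rewrite (@integral_distribution _ _ _ _ _ P idX (fun x => (f x)%:E * b%:E)%E)//.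
  by apply/measurable_EFinP; exact: measurable_funM.
exact: integrableZr.
Qed.

(** The product of inner products is the inner product of two elementary
    tensors. Coordinate by coordinate, independence splits the expectation
    into two factors, each equal to n! times a signature coordinate. *)
Lemma expectation_prod_edot n (U V : 'I_n -> {RV P >-> R}) :
  iid_uniform01 U -> iid_uniform01 V ->
  independent_collections P (fun i : 'I_n => order_stat U i)
                            (fun i : 'I_n => order_stat V i) ->
  (\int[P]_w (\prod_(i < n) edot (dx (order_stat U i w)) (dx (order_stat V i w)))%:E
   = (n`!%:R ^+ 2 * \sum_(I : {ffun 'I_n -> 'I_d}) iterated_integral dx I 1 ^+ 2)%:E)%E.
Proof.
move=> iidU iidV indUV.
pose A (X : 'I_n -> {RV P >-> R}) (I : {ffun 'I_n -> 'I_d}) w : R :=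
  \prod_(i < n) dx (order_stat X i w) 0 (I i).
have mO (X : 'I_n -> {RV P >-> R}) i : measurable_fun setT (order_stat X (i : 'I_n)).
  exact: measurable_order_stat.
have AC (X : 'I_n -> {RV P >-> R}) I w : `|A X I w| <= C ^+ n.
  rewrite normr_prod (_ : C ^+ n = \prod_(i < n) C).
    by apply: ler_prod => i _; rewrite normr_ge0 dxC.
  by rewrite prodr_const card_ord.
have mA (X : 'I_n -> {RV P >-> R}) I :
    measurable_fun (setT : set (g_sigma_algebraType
      (collection_sets (fun i : 'I_n => order_stat X i)))) (A X I).
  apply: measurable_prod => i _; apply: (measurableT_comp (mdx _)).
  exact: measurable_collection.
have intA (X : 'I_n -> {RV P >-> R}) I : measurable_fun setT (A X I).
  apply: measurable_prod => i _; exact: (measurableT_comp (mdx _)).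
have EA (I : {ffun 'I_n -> 'I_d}) : (\int[P]_w (A U I w * A V I w)%:E =
    (n`!%:R ^+ 2 * iterated_integral dx I 1 ^+ 2)%:E)%E.
  rewrite (expectation_mul_independent _ _ indUV (mA U I) (mA V I) (AC U I) (AC V I))//.
  by rewrite !(expectation_order_stat mdx dxC)// -EFinM mulrACA -!expr2.
under eq_integral => w _.
  rewrite -hs_dot_otimes /hs_dot -sumEFin; over.
rewrite integral_sum//=; last first.
  move=> I; apply: (@bounded_expectation_integrable _ _ _ _
    (fun w => A U I w * A V I w) (C ^+ n * C ^+ n)).
    exact: measurable_funM.
  by move=> w; rewrite normrM ler_pM.
under eq_bigr do rewrite EA.
by rewrite sumEFin mulr_sumr.
Qed.
End product_of_order_statistics.

(** * Wasserstein distances of empirical measures and the logarithmic series *)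

Section wasserstein_empirical.
Context (R : realType).

(** The uniform measure on the pairs (x k, y k). The number of points is written
    n.+1 so that this is a probability measure without side condition. *)
Definition empirical_coupling (n : nat) (x y : nat -> R) :
    set (measurableTypeR R * measurableTypeR R) -> \bar R :=
  mscale (n.+1%:R^-1)%:nng
    (msum (fun k => dirac ((x k : measurableTypeR R), (y k : measurableTypeR R))) n.+1).

HB.instance Definition _ n x y := Measure.on (@empirical_coupling n x y).

Let empirical_coupling_setT n x y : @empirical_coupling n x y setT = 1%E.
Proof.
rewrite /empirical_coupling /mscale/= /msum.
rewrite (eq_bigr (fun=> 1%E)) => [|k _]; last exact: diracT.
by rewrite sumEFin sumr_const card_ord -EFinM mulVf.
Qed.

HB.instance Definition _ n x y := @Measure_isProbability.Build _ _ R
  (@empirical_coupling n x y) (@empirical_coupling_setT n x y).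

Lemma coupling_empirical n x y :
  coupling (empirical_measure n.+1 x) (empirical_measure n.+1 y)
    (@empirical_coupling n x y).
Proof.
move=> A mA; rewrite /empirical_coupling /empirical_measure /= /mscale/= /msum.
split; congr (_ * _)%E; apply: eq_bigr => i _; rewrite /= !diracE; congr (_%:R%:E).
  congr nat_of_bool; apply/idP/idP => /set_mem; last by move=> Ax; exact: mem_set.
  by case=> Ax _; exact: mem_set.
congr nat_of_bool; apply/idP/idP => /set_mem; last by move=> Ay; exact: mem_set.
by case=> _ Ay; exact: mem_set.
Qed.

Lemma wasserstein_pow_empirical_le n p (x y : nat -> R) : (0 < n)%N ->
  (wasserstein_pow p (empirical_measure n x) (empirical_measure n y)
   <= (n%:R^-1 * \sum_(i < n) `|x i - y i| ^+ p)%:E)%E.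
Proof.
case: n => // n _; apply: ereal_inf_lbound.
exists (@empirical_coupling n x y); first exact: coupling_empirical.
set f := fun z => _.
have mf : measurable_fun setT f.
  apply/measurable_EFinP; apply: measurable_funX; apply: measurableT_comp => //.
  exact: measurable_funB.
have f0 z : (0 <= f z)%E by rewrite lee_fin exprn_ge0.
rewrite ge0_integral_mscale// ge0_integral_measure_sum//.
rewrite EFinM; congr (_ * _)%E; rewrite -sumEFin; apply: eq_bigr => i _.
by rewrite integral_dirac// diracT mul1e.
Qed.

Lemma wasserstein_pow_ge0 p (mu nu : {measure set (measurableTypeR R) -> \bar R}) :
  (0 <= wasserstein_pow p mu nu)%E.
Proof.
apply: le_ereal_inf_tmp => _ [pi _ <-].
by apply: integral_ge0 => z _; rewrite lee_fin exprn_ge0.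
Qed.

End wasserstein_empirical.

Section logarithmic_series.
Context (R : realType).

(** The function (1 - s) exp (p s), with p the partial sum, has derivative
    - s^N exp (p s) <= 0 and value 1 at 0. *)
Lemma one_minus_le_expR (N : nat) (z : R) : 0 <= z -> z <= 1 ->
  1 - z <= expR (- \sum_(k < N) z ^+ k.+1 / k.+1%:R).
Proof.
move=> z0 z1.
pose h (k : 'I_N) (s : R) : R := s ^+ k.+1 / k.+1%:R.
pose p : R -> R := \sum_(k < N) h k.
have dp (s : R) : is_derive s 1 p (\sum_(k < N) s ^+ k).
  apply: is_derive_sum => k; have := is_derive_monomial k k.+1%:R s.
  by rewrite mulrAC mulfV// mul1r.
pose f : R -> R := (cst 1 - id) * (expR \o p).
have df (s : R) : is_derive s 1 f (- (s ^+ N * expR (p s))).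
  have := is_deriveM (is_deriveB (is_derive_cst (1 : R) s 1) (is_derive_id s (1:R)))
    (is_derive1_comp (is_derive_expR (p s)) (dp s)).
  move=> dfs; apply: is_derive_eq dfs _.
  have sN : s ^+ N = (s - 1) * (\sum_(k < N) s ^+ k) + 1 by rewrite -subrX1 subrK.
  rewrite sN /GRing.scale/= /(_ \o _)/= -[(cst 1 - id) s]/(1 - s); ring.
have cf : {within `[0, z], continuous f}.
  apply: continuous_subspaceT => s.
  by apply/differentiable_continuous/derivable1_diffP; exact: ex_derive.
have [c] := MVT_segment z0 (fun x _ => df x) cf.
rewrite in_itv/= => /andP[c0 _] fz.
have f0 : f 0 = 1.
  rewrite /f -[LHS]/((1 - 0) * expR (p 0)) subr0 mul1r -expR0; congr expR.
  by rewrite /p fct_sumE big1// => k _; rewrite /h expr0n mul0r.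
have fz1 : (1 - z) * expR (p z) <= 1.
  rewrite -[leLHS]/(f z) -f0 -subr_le0 fz mulrC mulr_ge0_le0//.
    by rewrite subr0.
  by rewrite oppr_le0 mulr_ge0 ?exprn_ge0 ?expR_ge0.
rewrite expRN -[leRHS]mul1r ler_pdivlMr ?expR_gt0//.
by move: fz1; rewrite /p fct_sumE.
Qed.

End logarithmic_series.

Section exponential_bound.
Context (R : realType).

(** With z_i = c |x i - y i|^2 / 2 one has
    z_i^k / k = c^k / (k 2^k) * |x i - y i|^(2k), so summing the logarithmic
    series over i bounds n times each partial sum of the Wasserstein series by
    minus the logarithm of the product; the bound passes to the limit. *)
Lemma prod_le_expR_wasserstein (n : nat) (c : R) (x y : nat -> R) :
  (0 < n)%N -> 0 <= c <= 1 -> (forall i : 'I_n, `|x i - y i| <= 1) ->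
  \prod_(i < n) (1 - c * `|x i - y i| ^+ 2 / 2) <=
  fine (expeR (- (n%:R%:E * \sum_(1 <= k <oo)
     ((c ^+ k / (k%:R * 2 ^+ k))%:E
      * wasserstein_pow (2 * k) (empirical_measure n x) (empirical_measure n y)))))%E.
Proof.
move=> n0 /andP[c0 c1] xy1.
pose z (i : 'I_n) := c * `|x i - y i| ^+ 2 / 2.
have z0 i : 0 <= z i by rewrite divr_ge0// mulr_ge0// exprn_ge0.
have z1 i : z i < 1.
  rewrite /z ltr_pdivrMr// mul1r (le_lt_trans _ (ltr_nat R 1 2))//.
  rewrite mulr_ile1// ?exprn_ge0// exprn_ile1//; exact: xy1.
pose Q := \prod_(i < n) (1 - z i).
have Q0 : 0 < Q by apply: prodr_gt0 => i _; rewrite subr_gt0.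
pose u k := ((c ^+ k / (k%:R * 2 ^+ k))%:E
   * wasserstein_pow (2 * k) (empirical_measure n x) (empirical_measure n y))%E.
pose S := (\sum_(1 <= k <oo) u k)%E.
rewrite -[X in (n%:R%:E * X)%E]/S.
have n0' : 0 < n%:R :> R by rewrite ltr0n.
have coef_ge0 k : 0 <= c ^+ k / (k%:R * 2 ^+ k).
  by rewrite divr_ge0 ?exprn_ge0 ?mulr_ge0.
have u0 k : (0 <= u k)%E by rewrite mule_ge0 ?lee_fin//; exact: wasserstein_pow_ge0.
pose v (k : nat) (i : 'I_n) := z i ^+ k.+1 / k.+1%:R.
have vQ N : \sum_(i < n) \sum_(k < N) v k i <= - ln Q.
  rewrite lerNr -ler_expR lnK ?posrE// -sumrN expR_sum.
  apply: ler_prod => i _; rewrite subr_ge0 ltW//=.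
  by apply: one_minus_le_expR => //; exact: ltW.
have lnQ0 : 0 <= - ln Q.
  by apply: le_trans (vQ 0%N); rewrite big1// => i _; rewrite big_ord0.
have uv k : (u k.+1 <= (n%:R^-1 * \sum_(i < n) v k i)%:E)%E.
  apply: le_trans (lee_wpmul2l _ (wasserstein_pow_empirical_le _ _ _ n0)) _.
    by rewrite lee_fin.
  rewrite -EFinM lee_fin mulrCA ler_wpM2l ?invr_ge0 ?ler0n// mulr_sumr.
  apply: ler_sum => i _; rewrite /v /z exprMn exprVn exprMn exprM invfM.
  have comm (A B D E : R) : A * (E / D) * B = A * B / D * E.
    by rewrite mulrAC [E / D]mulrC mulrA.
  by rewrite comm.
have uN N : (\sum_(1 <= k < N) u k <= (- ln Q / n%:R)%:E)%E.
  case: N => [|N]; first by rewrite big_geq// lee_fin divr_ge0.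
  rewrite big_add1 big_mkord.
  apply: (@le_trans _ _ (\sum_(k < N) (n%:R^-1 * \sum_(i < n) v k i)%:E)%E).
    exact: lee_sum.
  rewrite sumEFin lee_fin -mulr_sumr exchange_big mulrC ler_pM2r ?invr_gt0//.
have S0 : (0 <= S)%E by apply: nneseries_ge0.
have SQ : (S <= (- ln Q / n%:R)%:E)%E.
  by apply: lime_le; [exact: is_cvg_nneseries|exact: nearW].
have Sfin : S \is a fin_num by rewrite ge0_fin_numE// (le_lt_trans SQ) ?ltry.
rewrite -(fineK Sfin) -EFinM -EFinN /= -/Q.
rewrite -[leLHS]lnK ?posrE// ler_expR lerNr -ler_pdivlMl//.
by rewrite mulrC -lee_fin fineK.
Qed.
End exponential_bound.

(** * The bound on the signature *)

(** Split the expectation of p along A: on A use p <= H, off A use p <= 1. *)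
Lemma le_expectation_indic d (T : measurableType d) (R : realType)
    (P : probability T R) (p H : T -> R) (A : set T) :
  measurable A -> measurable_fun setT p -> (forall w, `|p w| <= 1) ->
  (forall w, 0 <= H w) -> (forall w, A w -> 0 <= p w <= H w) ->
  (\int[P]_w (p w)%:E <= 'E_P[(fun w => H w * \1_A w)%R] + P (~` A))%E.
Proof.
move=> mA mp p1 H0 pH.
have m1 (B : set T) : measurable B -> measurable_fun setT (\1_B : T -> R).
  exact: measurable_indic.
have i1 (B : set T) w : `|\1_B w : R| <= 1.
  by rewrite indicE normr_nat lern1 leq_b1.
have mC : measurable (~` A) by exact: measurableC.
have intpA : P.-integrable setT (fun w => (p w * \1_A w)%:E).
  apply: (@bounded_expectation_integrable _ _ _ _ _ 1) => [|w].
    by apply: measurable_funM => //; exact: m1.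
  by rewrite normrM mulr_ile1.
have intC : P.-integrable setT (fun w => (\1_(~` A) w : R)%:E).
  by apply: (@bounded_expectation_integrable _ _ _ _ _ 1) => //; exact: m1.
apply: (@le_trans _ _ (\int[P]_w ((p w * \1_A w)%:E + (\1_(~` A) w)%:E))%E).
  apply: le_integral => //.
  - by apply: (@bounded_expectation_integrable _ _ _ _ _ 1).
  - exact: integrableD.
  move=> w _; rewrite -EFinD lee_fin !indicE in_setC.
  by case: (w \in A); rewrite ?mulr1 ?addr0// mulr0 add0r (le_trans (ler_norm _)).
rewrite integralD// integral_indic// setIT leeD2r//.
rewrite unlock; apply: ge0_le_integral_nonmeasurable => w.
  rewrite lee_fin indicE; case: (boolP (w \in A)) => [/set_mem/pH/andP[p0 _]|_].
    by rewrite mulr1.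
  by rewrite mulr0.
rewrite lee_fin indicE; case: (boolP (w \in A)) => [/set_mem/pH/andP[_ pHw]|_].
  by rewrite !mulr1.
by rewrite !mulr0.
Qed.

(** The probabilistic half of the argument. The geometry of the curve enters
    only through the two bounds on <g x, g y> for close parameters x and y. *)
Lemma order_statistic_expectation_bound (R : realType) (d : nat)
    (gamma' : R -> 'rV[R]_d) (a b : R) (F : R -> R) (phi eps : R) :
  let g := gamma' \o F in
  a <= b -> F a = 0 -> F b = 1 ->
  {within `[a, b], continuous F} ->
  (forall s t, a <= s -> s < t -> t <= b -> F s < F t) ->
  {within `[0, 1], continuous gamma'} ->
  (forall t, t \in `[a, b] -> enorm (g t) = 1) ->
  0 <= phi <= 1 -> 0 < eps <= 1 ->
  (forall x y, x \in `[a, b] -> y \in `[a, b] -> `|x - y| < eps ->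
     1 - `|x - y| ^+ 2 / 2 <= edot (g x) (g y) <= 1 - (1 - phi) * `|x - y| ^+ 2 / 2) ->
  forall (n : nat) (disp : measure_display) (T : measurableType disp)
      (P : probability T R) (U V : 'I_n -> {RV P >-> R})
      (X := fun k w => inverse_on a b F (order_stat U k w))
      (Y := fun k w => inverse_on a b F (order_stat V k w))
      (muX := fun w => empirical_measure n (X^~ w))
      (muY := fun w => empirical_measure n (Y^~ w))
      (dist := fun w => max_dist n (X^~ w) (Y^~ w)),
  (0 < n)%N -> iid_uniform01 U -> iid_uniform01 V ->
  independent_collections P (fun i : 'I_n => order_stat U i)
                            (fun i : 'I_n => order_stat V i) ->
  ((n`!%:R ^+ 2 * \sum_(I : {ffun 'I_n -> 'I_d}) iterated_integral gamma' I 1 ^+ 2)%:E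
     <= 'E_P[(fun w =>
           fine (expeR (- (n%:R%:E *
             \sum_(1 <= k <oo)
               (((1 - phi) ^+ k / (k%:R * 2 ^+ k))%:E
                * wasserstein_pow (2 * k) (muX w) (muY w)))))
           * \1_[set w' | (dist w' < eps)%R] w)%R]
        + P [set w | (eps <= dist w)%R])%E.
Proof.
move=> g ab Fa Fb cF F_lt cgamma g1 /andP[phi0 phi1] /andP[eps0 eps1] chord.
move=> n disp T P U V X Y muX muY dist n0 iidU iidV indUV.
have Gab u := inverse_on_segment ab cF F_lt Fa Fb u.
have mG := measurable_inverse_on ab cF F_lt Fa Fb.
have mX k : (k < n)%N -> measurable_fun setT (X k).
  move=> kn; apply: (measurableT_comp mG).
  exact: (@measurable_order_stat _ _ _ _ U (Ordinal kn)).
have mY k : (k < n)%N -> measurable_fun setT (Y k).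
  move=> kn; apply: (measurableT_comp mG).
  exact: (@measurable_order_stat _ _ _ _ V (Ordinal kn)).
(* h is a globally defined substitute for gamma': they agree on [0, 1], and h
   takes the value gamma' 0 elsewhere, so h is bounded and measurable. *)
pose h := g \o inverse_on a b F.
have h1 u : enorm (h u) = 1 by rewrite /h/= g1.
have hE u : 0 <= u <= 1 -> h u = gamma' u.
  by move=> u01; rewrite /h/g/=; have [_ ->] := inverse_on_image ab cF Fa Fb u01.
have hE' u : ~~ (0 <= u <= 1) -> h u = gamma' 0.
  by move=> u01; rewrite /h/g/= (inverse_on_outside F_lt Fa Fb u01) Fa.
have mh j : measurable_fun setT (fun u => h u 0 j).
  rewrite (_ : (fun _ => _) = (fun u =>
      if (0 <= u) && (u <= 1) then gamma' u 0 j else gamma' 0 0 j)); last first.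
    by apply/funext => u; case: (boolP (0 <= u <= 1)) => [/hE->|/hE'->].
  apply: measurable_fun_if => //.
  - by apply: measurable_and; exact: measurable_fun_ler.
  - have -> : setT `&` (fun u : R => (0 <= u) && (u <= 1)) @^-1` [set true]
        = `[0, 1]%classic.
      by apply/seteqP; split => u /=; rewrite in_itv/=; [case|split].
    apply: subspace_continuous_measurable_fun => //.
    move/subspace_continuousP : cgamma => cgamma.
    apply/subspace_continuousP => u u01.
    exact: (cvg_comp _ _ (cgamma u u01) (@coord_continuous _ _ _ 0 j (gamma' u))).
have hC u j : `|h u 0 j| <= 1 by rewrite (le_trans (coord_le_enorm _ _))// h1.
have -> : \sum_(I : {ffun 'I_n -> 'I_d}) iterated_integral gamma' I 1 ^+ 2 =
    \sum_(I : {ffun 'I_n -> 'I_d}) iterated_integral h I 1 ^+ 2.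
  by apply: eq_bigr => I _; rewrite (eq_iterated_integral (c:=1) I hE).
rewrite -(expectation_prod_edot mh hC iidU iidV indUV).
have mdist : measurable_fun setT dist.
  apply: measurable_bigmax => i; apply: measurableT_comp => //.
  by apply: measurable_funB; [exact: mX|exact: mY].
have -> : [set w | eps <= dist w] = ~` [set w | dist w < eps].
  by apply/seteqP; split => w /=; [rewrite leNgt => /negP|move/negP; rewrite -leNgt].
apply: le_expectation_indic.
- rewrite -[X in measurable X]setTI.
  have -> : [set w | dist w < eps] = dist @^-1` `]-oo, eps[.
    by apply/seteqP; split => w /=; rewrite in_itv.
  exact: mdist.
- apply: measurable_prod => i _; apply: measurable_sum => j.
  by apply: measurable_funM; apply: (measurableT_comp (mh _));
    exact: measurable_order_stat.
- move=> w; rewrite normr_prod; apply: prodr_ile1 => i.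
  by rewrite normr_ge0/= (le_trans (normr_edot_le _ _))// !h1 mulr1.
- by move=> w; rewrite fine_ge0// expeR_ge0.
- move=> w /= dw.
  have XY (i : 'I_n) : `|X i w - Y i w| < eps.
    apply: le_lt_trans dw; exact: (le_bigmax _ (fun i : 'I_n => `|X i w - Y i w|)).
  have chordi (i : 'I_n) :=
    chord _ _ (Gab (order_stat U i w)) (Gab (order_stat V i w)) (XY i).
  have chord0 (i : 'I_n) : 0 <= edot (g (X i w)) (g (Y i w)).
    have /andP[+ _] := chordi i; apply: le_trans.
    have := XY i; rewrite -/(X i w) -/(Y i w); set z := `|_|.
    have z0 : 0 <= z by exact: normr_ge0.
    by nra.
  apply/andP; split; first by apply: prodr_ge0 => i _; exact: chord0.
  apply: le_trans (prod_le_expR_wasserstein n0 _ _).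
  - apply: ler_prod => i _; rewrite chord0/=.
    by have /andP[] := chordi i.
  - by rewrite subr_ge0 phi1 gerBl.
  - by move=> i; rewrite (le_trans (ltW (XY i))).
Qed.
Theorem proposition19 (R : realType) (d : nat) (gamma : R -> 'rV[R]_d)
  (gamma' := derive_on `[0, 1] gamma)
  (gamma'' := derive_on `[0, 1] gamma')
  (kappa := fun s => enorm (gamma'' s))
  (gamma_derivable : derivable_on `[0, 1] gamma)
  (gamma'_derivable : derivable_on `[0, 1] gamma')
  (gamma''_continuous : {within `[0, 1], continuous gamma''})
  (unit_speed : forall s : R, s \in `[0, 1] -> enorm (gamma' s) = 1)
  (kappa_nonvanishing : forall s : R, s \in `[0, 1] -> kappa s != 0)
  (kappa_derivable : derivable_on (V := R^o) `[0, 1] kappa)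
  (kappa_bounded_derivative : exists M : R, forall s : R, s \in `[0, 1] ->
     `|derive_on (V := R^o) `[0, 1] kappa s| <= M)
  (a b : R) (ab : a < b) (F : R -> R)
  (F_range : forall t : R, t \in `[a, b] -> F t \in `[0, 1])
  (F_nondecreasing : {in `[a, b] &, {homo F : s t / s <= t}})
  (F_right_continuous : forall t : R, t \in `[a, b[ -> F s @[s --> t^'+] --> F t)
  (F_derivable : forall t : R, t \in `]a, b[ -> derivable F t 1)
  (F_derivable2 : forall t : R, t \in `]a, b[ -> derivable (derive1 F) t 1)
  (F_integral : forall t : R, t \in `[a, b] ->
     F t = \int[lebesgue_measure]_(s in `[a, t]) (enorm (gamma'' (F s)))^-1)
  (Fa : F a = 0) (Fb : F b = 1)
  (g := gamma' \o F)
  (phi := modulus_of_continuity `[a, b] (derive_on `[a, b] g)) :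
  exists2 eps' : R, 0 < eps' <= 1 &
    forall (n : nat) (eps : R), (0 < n)%N -> 0 < eps < eps' ->
    forall (disp : measure_display) (T : measurableType disp)
      (P : probability T R) (U V : 'I_n -> {RV P >-> R})
      (X := fun k w => inverse_on a b F (order_stat U k w))
      (Y := fun k w => inverse_on a b F (order_stat V k w))
      (muX := fun w => empirical_measure n (X^~ w))
      (muY := fun w => empirical_measure n (Y^~ w))
      (dist := fun w => max_dist n (X^~ w) (Y^~ w)),
    iid_uniform01 U -> iid_uniform01 V ->
    independent_collections P (fun i : 'I_n => order_stat U i)
                              (fun i : 'I_n => order_stat V i) ->
    (((n`!)%:R ^+ 2 * hs_norm (signature gamma n) ^+ 2)%:E
     <= 'E_P[(fun w =>
           fine (expeR (- (n%:R%:E *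
             \sum_(1 <= k <oo)
               (((1 - phi eps) ^+ k / (k%:R * 2 ^+ k))%:E
                * wasserstein_pow (2 * k) (muX w) (muY w)))))
           * \1_[set w' | (dist w' < eps)%R] w)%R]
        + P [set w | (eps <= dist w)%R])%E.
Proof.
have cgamma'' := gamma''_continuous.
have cgamma' := derivable_on_continuous gamma'_derivable.
have ckappa : {within `[0, 1], continuous kappa}.
  move/subspace_continuousP : cgamma'' => c; apply/subspace_continuousP => s s01.
  exact: (cvg_comp _ _ (c s s01) (@continuous_enorm _ _ (gamma'' s))).
have kappa_gt0 s : s \in `[0, 1] -> 0 < kappa s.
  by move=> s01; rewrite lt_neqAle eq_sym kappa_nonvanishing//= enorm_ge0.
pose rho t := (kappa (F t))^-1.
have crho := density_continuous ab ckappa kappa_gt0 F_range F_derivable F_integral.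
have cF := cdf_continuous ab ckappa kappa_gt0 F_range F_derivable F_integral.
have F_lt' := cdf_lt ab ckappa kappa_gt0 F_range F_derivable F_integral.
have F_inj' := cdf_inj ab ckappa kappa_gt0 F_range F_derivable F_integral.
have F_dq := cdf_difference_quotient ab ckappa kappa_gt0 F_range F_derivable F_integral.
pose k t := rho t *: gamma'' (F t).
have g_dq t : t \in `[a, b] ->
    difference_quotient g t y @[y --> within `[a, b] t^'] --> k t.
  move=> tab; apply: (@difference_quotient_comp _ _ _ `[0, 1]%classic F gamma') => //.
  - by apply: F_dq.
  - by apply: derive_onP => //; exact: F_range.
have k_unit t : t \in `[a, b] -> enorm (k t) = 1.
  move=> /F_range Ft; rewrite enormZ ?invr_ge0 ?enorm_ge0//.
  by rewrite mulVf// kappa_nonvanishing.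
have g_unit t : t \in `[a, b] -> enorm (g t) = 1.
  by move=> /F_range/unit_speed.
have ck : {within `[a, b], continuous k}.
  have := continuous_within_comp F_range cF cgamma''.
  move/subspace_continuousP => c; apply/subspace_continuousP => t tab.
  apply: cvgZ; last exact: c.
  by move/subspace_continuousP : crho; exact.
(* An oscillation below 1 is all that is asked of the velocity, so as to have
   phi eps <= 1. *)
have [e' e'0 ke'] := uniformly_continuous_segment ck (@ltr01 R : 0 < 1).
have dgE t : t \in `[a, b] -> derive_on `[a, b] g t = k t.
  by move=> tab; apply: derive_on_eq (g_dq t tab) => //; rewrite in_itv in tab.
exists (Num.min 1 e'); first by rewrite lt_min ltr01 e'0 ge_min lexx.
move=> n eps n0 /andP[eps0]; rewrite lt_min => /andP[eps1 epse'].
move=> disp T P U V X Y muX muY dist iidU iidV indUV.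
(* The set whose supremum is phi eps; it must be seen to be bounded, since the
   supremum of an unbounded set is a default value. *)
pose S := [set x : R | exists s t, [/\ `[a, b]%classic s, `[a, b]%classic t,
  `|s - t| < eps & x = enorm (derive_on `[a, b] g t - derive_on `[a, b] g s)]].
have S_le1 x : S x -> x <= 1.
  move=> [s [t [sab tab st ->]]]; rewrite !dgE//; apply/ltW/ke' => //.
  exact: lt_trans st epse'.
have supS : has_sup S.
  split; last by exists 1.
  by exists (enorm (derive_on `[a, b] g a - derive_on `[a, b] g a)), a, a;
    split; rewrite //= ?in_itv/= ?lexx ?ltW// subrr normr0.
have phiP s t : s \in `[a, b] -> t \in `[a, b] -> `|s - t| < eps ->
    enorm (k t - k s) <= phi eps.
  move=> sab tab st; apply: ub_le_sup; first by exists 1.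
  by exists s, t; split => //; rewrite !dgE.
have phi1 : phi eps <= 1 by apply: ge_sup; [exact: supS.1|exact: S_le1].
have phi0 : 0 <= phi eps.
  have aab : a \in `[a, b] by rewrite in_itv/= lexx ltW.
  by apply: le_trans (phiP a a aab aab _); rewrite ?enorm_ge0// subrr normr0.
have -> : n`!%:R ^+ 2 * hs_norm (signature gamma n) ^+ 2 =
    n`!%:R ^+ 2 * \sum_(I : {ffun 'I_n -> 'I_d}) iterated_integral gamma' I 1 ^+ 2.
  rewrite /hs_norm sqr_sqrtr; last by apply: sumr_ge0 => I _; rewrite -expr2 sqr_ge0.
  by congr (_ * _); apply: eq_bigr => I _; rewrite expr2.
apply: order_statistic_expectation_bound => //.
- exact: ltW.
- by rewrite phi0 phi1.
- by rewrite eps0 ltW.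
- move=> x y xab yab xy; apply/andP; split.
    exact: (edot_chord_ge g_unit k_unit g_dq xab yab xy phiP phi1).
  exact: (edot_chord_le g_unit k_unit g_dq xab yab xy phiP phi1).
Qed.
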